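(* Let $\Phi\colon[0,+\infty)\to[0,+\infty)$ be a generalized Orlicz function that is continuous and strictly increasing, and let $H_\Phi$ be the corresponding Orlicz premium on $L^\Phi_+$. Then: (a) $H_\Phi$ is cash-additive if and only if there exist $\alpha\in(0,1)$ and $p>0$ such that $$\Phi(x)\sim 1+\alpha (x-1)_+^p-(1-\alpha)(x-1)_-^p ,$$ which gives $H_\Phi(X)=z_{\alpha,p}(X)$. (b) $H_\Phi$ is cash-additive and convex (resp. concave) if and only if there exists $\alpha\in(0,1)$ with $\alpha\ge 1/2$ (resp. $\alpha\le 1/2$) such that $$\Phi(x)\sim 1+\alpha (x-1)_+-(1-\alpha)(x-1)_- ,$$ which gives $H_\Phi(X)=e_\alpha(X)$.
   Context: Random variables are defined on a nonatomic probability space $(\Omega,\mathcal F,P)$; (in)equalities between them hold $P$-a.s. A generalized Orlicz function is a function $\Phi\colon[0,+\infty)\to[0,+\infty)$ that is nondecreasing, left-continuous, and satisfies $\Phi(x)\le1$ for $x\le1$ and $\Phi(x)>1$ for $x>1$. Set $L^\Phi=\{X\in L^0: \mathbb E[\Phi(|X|/k)]\le1\text{ for some }k>0\}$, $L^\Phi_+=\{X\in L^\Phi: X\ge0\}$, and for $X\in L^\Phi_+$ the Orlicz premium is $H_\Phi(X)=\inf\{k>0:\mathbb E[\Phi(X/k)]\le1\}$ (with $\inf\emptyset=+\infty$ outside $L^\Phi_+$). Two functions satisfy $\Phi_1\sim\Phi_2$ if there is $c>0$ with $\Phi_2(x)=1+c(\Phi_1(x)-1)$ for all $x\in[0,+\infty)$.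 Here $(y)_+=\max(y,0)$, $(y)_-=\max(-y,0)$. $H_\Phi$ is cash-additive if $H_\Phi(X+c)=H_\Phi(X)+c$ for all $X\in L^\Phi_+$ and all $c\in[0,+\infty)$. $H_\Phi$ is convex (resp. concave) if $H_\Phi(\lambda X+(1-\lambda)Y)\le$ (resp. $\ge$) $\lambda H_\Phi(X)+(1-\lambda)H_\Phi(Y)$ for all $X,Y\in L^\Phi_+$ and $\lambda\in[0,1]$. For $X\ge0$ with $\mathbb E[X^p]<+\infty$, $z_{\alpha,p}(X)=\inf\{k>0:\alpha\mathbb E[(X-k)_+^p]\le(1-\alpha)\mathbb E[(X-k)_-^p]\}$ (the $L^{p+1}$-quantile), and $e_\alpha(X)=z_{\alpha,1}(X)$ (the $\alpha$-expectile). *)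

(* Defs.v *)
From HB Require Import structures.
From mathcomp Require Export all_boot all_order all_algebra.
From mathcomp Require Export all_classical all_reals all_analysis.

Set Implicit Arguments.
Unset Strict Implicit.
Unset Printing Implicit Defensive.

Import Order.TTheory GRing.Theory Num.Theory.
Import numFieldNormedType.Exports.

Local Open Scope classical_set_scope.
Local Open Scope ring_scope.
Local Open Scope ereal_scope.

Definition nonatomic d (T : measurableType d) (R : realType)
    (P : probability T R) : Prop :=
  forall A : set T, measurable A -> 0 < P A ->
    exists B : set T, [/\ measurable B, B `<=` A, 0 < P B & P B < P A].

Definition pos_part (R : realType) (y : R) : R := Num.max y 0%R.
Definition neg_part (R : realType) (y : R) : R := Num.max (- y)%R 0%R.

(* A function [0,+oo) -> [0,+oo) is encoded as Phi : R -> R, of which only the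
   restriction to [0,+oo) is ever constrained. *)
Record generalized_orlicz (R : realType) (Phi : R -> R) : Prop := {
  gorlicz_ge0 : forall x : R, (0 <= x)%R -> (0 <= Phi x)%R ;
  gorlicz_nondecreasing :
    {in `[0%R, +oo[ &, {homo Phi : x y / (x <= y)%R}} ;
  gorlicz_left_continuous : forall x : R, (0 < x)%R -> Phi @ x^'- --> Phi x ;
  gorlicz_le1 : forall x : R, (0 <= x)%R -> (x <= 1)%R -> (Phi x <= 1)%R ;
  gorlicz_gt1 : forall x : R, (1 < x)%R -> (1 < Phi x)%R }.

Definition orlicz_equiv (R : realType) (Phi1 Phi2 : R -> R) : Prop :=
  exists2 c : R, (0 < c)%R &
    forall x : R, (0 <= x)%R -> (Phi2 x = 1 + c * (Phi1 x - 1))%R.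

Section orlicz_premium.
Context d (T : measurableType d) (R : realType) (P : probability T R).

Definition orlicz_space (Phi : R -> R) : set {RV P >-> R} :=
  [set X | exists2 k : R, (0 < k)%R & 'E_P[fun w => Phi (`|X w| / k)%R] <= 1].

Definition orlicz_space_ge0 (Phi : R -> R) : set {RV P >-> R} :=
  [set X | orlicz_space Phi X /\ \forall w \ae P, (0 <= X w)%R].

(* Extended-real valued, as the infimum of the empty set is +oo. When X >= 0
   almost surely, Phi is applied to negative arguments only on a null set,
   which does not affect the expectation. *)
Definition orlicz_premium (Phi : R -> R) (X : T -> R) : \bar R :=
  ereal_inf [set k%:E | k in
    [set k : R | (0 < k)%R /\ 'E_P[fun w => Phi (X w / k)%R] <= 1]].

Definition cash_additive (Phi : R -> R) : Prop :=
  forall X : {RV P >-> R}, orlicz_space_ge0 Phi X ->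
  forall c : R, (0 <= c)%R ->
    orlicz_premium Phi (fun w => X w + c)%R = orlicz_premium Phi X + c%:E.

Definition premium_convex (Phi : R -> R) : Prop :=
  forall X Y : {RV P >-> R}, orlicz_space_ge0 Phi X -> orlicz_space_ge0 Phi Y ->
  forall l : R, (0 <= l <= 1)%R ->
    orlicz_premium Phi (fun w => l * X w + (1 - l) * Y w)%R <=
    l%:E * orlicz_premium Phi X + (1 - l)%:E * orlicz_premium Phi Y.

Definition premium_concave (Phi : R -> R) : Prop :=
  forall X Y : {RV P >-> R}, orlicz_space_ge0 Phi X -> orlicz_space_ge0 Phi Y ->
  forall l : R, (0 <= l <= 1)%R ->
    l%:E * orlicz_premium Phi X + (1 - l)%:E * orlicz_premium Phi Y <=
    orlicz_premium Phi (fun w => l * X w + (1 - l) * Y w)%R.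

(* Meaningful for X >= 0 almost surely with 'E_P[X ^ p] < +oo. *)
Definition Lp_quantile (alpha p : R) (X : T -> R) : \bar R :=
  ereal_inf [set k%:E | k in [set k : R | (0 < k)%R /\
    alpha%:E * 'E_P[fun w => (pos_part (X w - k) `^ p)%R] <=
    (1 - alpha)%:E * 'E_P[fun w => (neg_part (X w - k) `^ p)%R]]].

Definition expectile (alpha : R) (X : T -> R) : \bar R :=
  Lp_quantile alpha 1 X.

End orlicz_premium.

Arguments orlicz_premium {d T R} P Phi X.
Arguments cash_additive {d T R} P Phi.
Arguments premium_convex {d T R} P Phi.
Arguments premium_concave {d T R} P Phi.
Arguments Lp_quantile {d T R} P alpha p X.
Arguments expectile {d T R} P alpha X.
Arguments orlicz_space {d T R} P Phi.
Arguments orlicz_space_ge0 {d T R} P Phi.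

Local Close Scope ereal_scope.

Definition Lp_quantile_orlicz (R : realType) (alpha p : R) (x : R) : R :=
  1 + alpha * (pos_part (x - 1)) `^ p - (1 - alpha) * (neg_part (x - 1)) `^ p.

Definition expectile_orlicz (R : realType) (alpha : R) (x : R) : R :=
  1 + alpha * pos_part (x - 1) - (1 - alpha) * neg_part (x - 1).

(* Main.v *)
(* For X with values x and y on complementary events, H(X) = 1 means that
   E[Phi(X)] = 1. On a nonatomic space the weights can be chosen to balance any
   x < 1 < y, and then H(X + c) = 1 + c says that g(t) = Phi(1 + t) - 1 satisfies
   g(l t) g(s) = g(l s) g(t) for s < 0 < t and l = 1 / (1 + c). Hence
   g(l t) / g(t) is a multiplicative function of l alone, that is l^p, and g is a
   power on each side of 0. Conversely, for such a Phi, multiplying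
   E[Phi(X / k)] <= 1 by k^p turns it into a condition on X - k, which is
   translation invariant.
   Convexity (concavity) of H, tested on variables taking the values (u, v, z)
   and (v, u, z) on the same three events, makes Phi midpoint convex (concave);
   at the pairs (0, 1), (1, 3) and (0, 2) this forces p = 1 and the sign of
   alpha - 1/2. *)

From HB Require Import structures.
Require Import Defs.
From mathcomp Require Import measurable_realfun ring lra.
Set Implicit Arguments.
Unset Strict Implicit.
Unset Printing Implicit Defensive.
Import Order.TTheory GRing.Theory Num.Theory.
Import numFieldNormedType.Exports.
Local Open Scope classical_set_scope.
Local Open Scope ring_scope.

(** * Measure-theoretic preliminaries *)

(** The exponent is the same on both sides of 0 because one equation couples g at s < 0 with g at t
    > 0: the ratios g(l t) / g(t) and g(l s) / g(s) are the same function of l. Monotonicity is the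
    regularity that turns this function into a power. The test for p = 1 works since (x - 1)^p to
    the right of 1 is convex only for p >= 1, and -(1 - x)^p to the left of 1 only for p <= 1. In
    the converse directions the difficulties lie at the edges. E[(X - k)_+^p] may be infinite while
    E[(X - k)_-^p] is at most k^p, so the two are never subtracted. The infimum runs over k > 0
    only, so a shift by c leaves the range k <= c to be treated apart. Variables are nonnegative
    only almost surely, so they are replaced by their positive parts. Convexity of H follows from
    that of [Phi] by the usual gauge argument; concavity is not its mirror image, and is proved by
    contradiction after vanishing premiums have been excluded. *)

Section expectation_ae_eq.
Context d (T : measurableType d) (R : realType) (P : probability T R).
Import HBNNSimple.

(** The integral of a nonnegative function is a supremum over simple functions below it. Cutting
    such an [h] below [f] down to the complement of [N] puts it below [g] and leaves its integral
    unchanged. *)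
Let le_integral_off_null (f g : T -> \bar R) (N : set T) :
  measurable N -> P N = 0%E -> (forall x, 0 <= f x)%E -> (forall x, 0 <= g x)%E ->
  (forall x, ~ N x -> f x = g x) ->
  (\int[P]_x f x <= \int[P]_x g x)%E.
Proof.
move=> mN PN f0 g0 fg; rewrite !ge0_integralTE//.
apply: ge_ereal_sup => _ [h /= hf <-].
have mC := measurableC mN.
apply: le_trans; last first.
  apply: ereal_sup_ubound => /=; exists (proj_nnsfun h mC) => //= x.
  rewrite /= mindicE; case: (pselect (N x)) => Nx.
    by rewrite memNset ?mulr0//; exact.
  by rewrite mem_set// mulr1 -fg.
rewrite -!integralT_nnsfun.
rewrite (@ge0_ae_eq_integral _ _ _ P setT _ (fun x => (proj_nnsfun h mC x)%:E))//.
- exact/measurable_EFinP.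
- exact/measurable_EFinP.
- by move=> x _; rewrite lee_fin; exact: fun_ge0.
- by move=> x _; rewrite lee_fin; exact: fun_ge0.
exists N; split => // x /= /not_implyP[_]; apply: contra_notP => Nx.
by rewrite /= mindicE mem_set// mulr1.
Qed.

(* No measurability is required: Phi is arbitrary on negative numbers, so
   Phi (X / k) need not be measurable when X >= 0 only almost surely. *)
Lemma expectation_ae_eq (f g : T -> R) :
  (\forall x \ae P, f x = g x) -> ('E_P[f] = 'E_P[g])%E.
Proof.
move=> [N [mN PN fgN]]; rewrite unlock.
have fg x : ~ N x -> f x = g x by apply: contra_notP => ?; exact: fgN.
rewrite integralE [RHS]integralE.
congr (_ - _)%E; apply/eqP; rewrite eq_le; apply/andP; split;
  apply: (le_integral_off_null mN PN) => // x;
  by [rewrite ?funeposE ?funenegE le_max lexx orbT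
     | move=> /fg; rewrite ?funeposE ?funenegE => ->].
Qed.
End expectation_ae_eq.

(** * Subsets of prescribed measure in a nonatomic space *)

Section sierpinski.
Context d (T : measurableType d) (R : realType) (P : probability T R).
Hypothesis P_nonatomic : nonatomic P.

Let fineP A : measurable A -> P A = (fine (P A))%:E.
Proof. by move=> mA; rewrite fineK// fin_num_measure. Qed.

Let fineP_D A B : measurable A -> measurable B -> B `<=` A ->
  fine (P (A `\` B)) = fine (P A) - fine (P B).
Proof.
move=> mA mB BA; rewrite measureD//; last by rewrite -ge0_fin_numE ?fin_num_measure.
by rewrite setIidr// fineB// fin_num_measure.
Qed.

Let fineP_U A B : measurable A -> measurable B -> [disjoint A & B] ->
  fine (P (A `|` B)) = fine (P A) + fine (P B).
Proof.
by move=> mA mB /eqP AB; rewrite measureU// fineD// fin_num_measure.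
Qed.

Let fineP_le A B : measurable A -> measurable B -> A `<=` B ->
  fine (P A) <= fine (P B).
Proof.
by move=> mA mB AB; rewrite fine_le ?fin_num_measure// le_measure ?inE.
Qed.

(** A set of positive measure splits into two pieces of positive measure, and the smaller one has at
    most half the mass. *)
Lemma nonatomic_halving A (n : nat) : measurable A -> 0 < fine (P A) ->
  exists B, [/\ measurable B, B `<=` A, 0 < fine (P B) &
    fine (P B) <= fine (P A) / 2 ^+ n].
Proof.
move=> mA A0; elim: n => [|n [B [mB BA B0 Bn]]].
  by exists A; rewrite expr0 divr1; split.
have [|C [mC CB C0 CltB]] := P_nonatomic mB; first by rewrite fineP ?lte_fin.
have {}C0 : 0 < fine (P C) by rewrite -lte_fin -fineP.
have {}CltB : fine (P C) < fine (P B) by rewrite -lte_fin -!fineP.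
have eD := fineP_D mB mC CB.
have e2 : fine (P A) / 2 ^+ n.+1 = fine (P A) / 2 ^+ n / 2.
  by rewrite exprS; field; rewrite expf_neq0.
have [CB2|CB2] := leP (fine (P C)) (fine (P B) / 2).
  exists C; split => //; first exact: subset_trans BA.
  by rewrite e2; lra.
exists (B `\` C); split => //; first exact: measurableD.
- by move=> x [/BA].
- by rewrite eD; lra.
- by rewrite eD e2; lra.
Qed.

Lemma nonatomic_small A (e : R) : measurable A -> 0 < fine (P A) -> 0 < e ->
  exists B, [/\ measurable B, B `<=` A, 0 < fine (P B) & fine (P B) <= e].
Proof.
move=> mA A0 e0.
(* The number n of halvings exceeds P(A) / e, which is enough because n < 2^n. *)
have [B [mB BA B0 Bn]] := nonatomic_halving (Num.truncn (fine (P A) / e)).+1 mA A0.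
exists B; split => //; apply: le_trans Bn _.
rewrite ler_pdivrMr ?exprn_gt0// mulrC -ler_pdivrMr//.
apply: le_trans (ltW (truncnS_gt _)) _.
by rewrite -natrX ler_nat ltnW// ltn_expl.
Qed.

(* Greedy exhaustion: each step adds at least half of the largest mass that can
   still be added without exceeding a. *)
Lemma nonatomic_subset D (a : R) : measurable D -> 0 <= a <= fine (P D) ->
  exists A, [/\ measurable A, A `<=` D & fine (P A) = a].
Proof.
move=> mD /andP[a0 aD].
pose good A := [/\ measurable A, A `<=` D & fine (P A) <= a].
have /choice[next nextP] A : exists A', good A -> [/\ good A', A `<=` A' &
    forall C, measurable C -> C `<=` D `\` A -> fine (P A) + fine (P C) <= a ->
      fine (P C) <= 2 * (fine (P A') - fine (P A))].
  have [gA|] := pselect (good A); last by exists A.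
  have [mA AD Aa] := gA.
  pose S : set R := [set fine (P C) | C in
    [set C | [/\ measurable C, C `<=` D `\` A & fine (P A) + fine (P C) <= a]]].
  have S0 : S 0.
    exists set0; last by rewrite measure0.
    by split => //; rewrite measure0/= addr0.
  have supS : has_sup S.
    split; first by exists 0.
    by exists a => _ [C [mC _ Ca] <-]; have := fine_ge0 (measure_ge0 P A); lra.
  have upS := ub_le_sup supS.2.
  have [s0|s0] := leP (sup S) 0.
    exists A => _; split => // C mC CD Ca.
    rewrite subrr mulr0; apply: le_trans s0; apply: upS.
    by exists C.
  (* The supremum need not be attained; any [C] above half of it will do, hence the factor 2. *)
  have [_ [C [mC CD Ca] <-]] := @sup_adherent _ S (sup S / 2) ltac:(lra) supS.
  move=> supC; exists (A `|` C) => _.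
  have disj : [disjoint A & C].
    by apply/eqP/seteqP; split => // x [Ax /CD[]].
  split.
  - split; [exact: measurableU | by move=> x [/AD|/CD[]] | by rewrite fineP_U].
  - by move=> x; left.
  - move=> C' mC' C'D C'a; rewrite fineP_U//.
    have : fine (P C') <= sup S by apply: upS; exists C'.
    lra.
pose A_ n := iter n next set0.
have good_ n : good (A_ n).
  elim: n => [|n ih]; first by split; rewrite /A_ /= ?measure0.
  by rewrite /A_ iterS; have [] := nextP _ ih.
have mA n : measurable (A_ n) by have [] := good_ n.
pose U := \bigcup_n A_ n.
have mU : measurable U by exact: bigcupT_measurable.
have UD : U `<=` D by move=> x [n _]; have [_ + _] := good_ n; exact.
have Ua : fine (P U) <= a.
  have ndA : nondecreasing_seq A_.
    apply/nondecreasing_seqP => n; apply/subsetPset.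
    by rewrite /A_ iterS; have [] := nextP _ (good_ n).
  have := nondecreasing_cvg_mu (mu := P) mA mU ndA => cvgU.
  rewrite -lee_fin -fineP// -(cvg_lim _ cvgU)//; apply: lime_le.
    by apply/cvg_ex; exists (P U).
  by near=> n; rewrite /= fineP// lee_fin; have [] := good_ n.
(* If P(U) < a, some [C] of positive mass outside [U] could have been added at every stage, so every
   step gained at least P(C) / 2. This contradicts the bound a on all the masses. *)
exists U; split => //; apply/eqP; rewrite eq_le Ua leNgt; apply/negP => aU.
have [|||C [mC CDU C0 Ca]] := @nonatomic_small (D `\` U) (a - fine (P U)).
- exact: measurableD.
- by rewrite fineP_D//; lra.
- lra.
have step n : fine (P C) <= 2 * (fine (P (A_ n.+1)) - fine (P (A_ n))).
  rewrite /A_ iterS; have [_ _] := nextP _ (good_ n); apply => //.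
    by move=> x /CDU [Dx nUx]; split => // Ax; apply: nUx; exists n.
  have : fine (P (A_ n)) <= fine (P U) by apply: fineP_le => // x Ax; exists n.
  lra.
have sum n : n%:R * fine (P C) <= 2 * fine (P (A_ n)).
  elim: n => [|n ih]; first by rewrite mul0r mulr_ge0// fine_ge0.
  by rewrite -natr1 mulrDl mul1r; have := step n; lra.
have := truncnS_gt (2 * a / fine (P C)).
rewrite ltr_pdivrMr// => /lt_le_trans /(_ (sum _)).
by have [_ _] := good_ (Num.truncn (2 * a / fine (P C))).+1; lra.
Unshelve. all: end_near. Qed.
End sierpinski.

(** * The functional equation *)

Section power_law.
Context (R : realType).
Implicit Types (u v l : R).

(** Additivity and nonnegativity give monotonicity. Squeezing n u between consecutive integers
    bounds n |f u - u f 1| by f 1 for every n, so the difference vanishes. *)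
Lemma additive_ge0_linear (f : R -> R) :
  (forall u v, 0 <= u -> 0 <= v -> f (u + v) = f u + f v) ->
  (forall u, 0 <= u -> 0 <= f u) ->
  forall u, 0 <= u -> f u = u * f 1.
Proof.
move=> fD f_ge0 u u0.
have f_le v w : 0 <= v -> v <= w -> f v <= f w.
  by move=> v0 vw; rewrite -(subrKC v w) fD ?subr_ge0// lerDl f_ge0 ?subr_ge0.
have fM n v : 0 <= v -> f (n%:R * v) = n%:R * f v.
  move=> v0; elim: n => [|n ih].
    by rewrite !mul0r; have := fD 0 0 (lexx _) (lexx _); rewrite addr0; lra.
  by rewrite -natr1 !mulrDl !mul1r fD ?mulr_ge0// ih.
have bound n : n%:R * `|f u - u * f 1| <= f 1.
  have nu0 : 0 <= n%:R * u by rewrite mulr_ge0.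
  have /andP[kn nk] := Num.Theory.truncn_itv nu0.
  set k := Num.truncn _ in kn nk.
  have := f_le _ _ (ler0n _ _) kn; have := f_le _ _ nu0 (ltW nk).
  rewrite (fM n)// -[k.+1%:R]mulr1 -[k%:R]mulr1 !fM// => h1 h2.
  have f10 := f_ge0 1 ler01.
  have h3 := ler_wpM2r f10 kn; have h4 := ler_wpM2r f10 (ltW nk).
  rewrite -[n%:R]ger0_norm// -normrM ler_norml mulrBr mulrA.
  by rewrite -natr1 in h1 h4; apply/andP; split; lra.
apply/eqP; rewrite -subr_eq0 -normr_eq0 eq_le normr_ge0 andbT leNgt.
apply/negP => D0.
have := truncnS_gt (f 1 / `|f u - u * f 1|).
by rewrite ltr_pdivrMr// ltNge bound.
Qed.

(** In the variable u = - ln l, the function - ln m is additive and nonnegative on u >= 0, hence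
    linear. The exponent is its slope, - ln (m (1/e)). *)
Lemma multiplicative_powR (m : R -> R) :
  (forall l k : R, 0 < l <= 1 -> 0 < k <= 1 -> m (l * k) = m l * m k) ->
  (forall l, 0 < l <= 1 -> 0 < m l) -> (forall l, 0 < l < 1 -> m l < 1) ->
  exists2 p, 0 < p & forall l, 0 < l <= 1 -> m l = l `^ p.
Proof.
move=> mM m_gt0 m_lt1.
have m_le1 l : 0 < l <= 1 -> m l <= 1.
  move=> /andP[l0]; rewrite le_eqVlt => /predU1P[->|l1]; last first.
    by apply/ltW/m_lt1; rewrite l0.
  have /(_ 1 1) := mM; rewrite ltr01 lexx mulr1 => /(_ erefl erefl).
  by have := m_gt0 1; rewrite ltr01 lexx => /(_ erefl); nra.
have e01 u : 0 <= u -> 0 < expR (- u) <= 1.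
  by move=> u0; rewrite expR_gt0 -[leRHS]expR0 ler_expR oppr_le0.
pose f u := - ln (m (expR (- u))).
have f_lin : forall u, 0 <= u -> f u = u * f 1.
  apply: additive_ge0_linear => [u v u0 v0|u u0]; rewrite /f.
    by rewrite opprD expRD mM ?e01// lnM ?posrE ?m_gt0 ?e01// opprD.
  by rewrite oppr_ge0 ln_le0// m_le1// e01.
exists (f 1).
  rewrite oppr_gt0 ln_lt0// m_gt0 ?e01// m_lt1//.
  by rewrite expR_gt0 expR_lt1 oppr_lt0 ltr01.
move=> l /andP[l0 l1]; have l_ge0 : 0 <= - ln l by rewrite oppr_ge0 ln_le0.
rewrite /powR gt_eqF// -[m l]lnK ?posrE ?m_gt0 ?l0//.
congr expR; have := f_lin _ l_ge0.
by rewrite {1}/f opprK lnK ?posrE//; lra.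
Qed.

(** The reference points are t = 1 and s = -1. The equation at (t, -1) combined with the one at (1,
    -1) gives g (l t) = m l g t for t > 0, where m l = g l / g 1. Hence m is multiplicative, and
    strict monotonicity gives m < 1 below 1. The negative side inherits the same m. *)
Lemma power_law (g : R -> R) :
  (forall t s l, 0 < t -> -1 <= s < 0 -> 0 < l <= 1 ->
     g (l * t) * g s = g (l * s) * g t) ->
  (forall t, 0 < t -> 0 < g t) -> (forall s, -1 <= s < 0 -> g s < 0) ->
  (forall t s, 0 < t < s -> g t < g s) ->
  exists2 p, 0 < p & (forall t, 0 < t -> g t = g 1 * t `^ p) /\
                     (forall t, 0 < t <= 1 -> g (- t) = g (- 1) * t `^ p).
Proof.
move=> gM gp gn g_lt.
have g1 := gp 1 ltr01.
have gN1 : g (-1) < 0 by apply: gn; rewrite lexx ltrN10.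
have gl s l : -1 <= s < 0 -> 0 < l <= 1 -> g (l * s) * g 1 = g l * g s.
  by move=> sP lP; rewrite -gM// mulr1.
pose m l := g l / g 1.
have glt t l : 0 < t -> 0 < l <= 1 -> g (l * t) = m l * g t.
  move=> t0 lP; have := gM t (-1) l t0; rewrite lexx ltrN10 => /(_ erefl lP) h1.
  have := gl (-1) l; rewrite lexx ltrN10 => /(_ erefl lP) h2.
  rewrite /m; apply: (mulIf (lt0r_neq0 g1)); apply: (mulIf (ltr0_neq0 gN1)).
  rewrite mulrAC h1 mulrAC h2; field; exact: lt0r_neq0.
have [|||p p0 mE] := @multiplicative_powR m.
- move=> l k lP /andP[k0 k1]; rewrite {1}/m glt// -mulrA//.
- by move=> l /andP[l0 _]; rewrite divr_gt0// gp.
- by move=> l lP; rewrite ltr_pdivrMr// mul1r g_lt.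
exists p => //; split=> [t t0|t tP].
  have [t1|t1] := leP t 1.
    by rewrite -mE ?t0// /m; field; exact: lt0r_neq0.
  (* As l is at most 1, the case t > 1 is read backwards: scaling t by l = t^-1 leads to 1. *)
  have t'P : 0 < t^-1 <= 1 by rewrite invr_gt0 t0 invf_le1// ltW.
  have := glt t _ t0 t'P; rewrite mulVf ?gt_eqF// mE// => ->.
  rewrite mulrAC -powRM ?invr_ge0 ?ltW// mulVf ?gt_eqF//.
  by rewrite powR1 /= mul1r.
rewrite -mE//; have := gl (-1) t; rewrite lexx ltrN10 => /(_ erefl tP).
rewrite mulrN1 /m => h; apply: (mulIf (lt0r_neq0 g1)).
by rewrite h; field; exact: lt0r_neq0.
Qed.
End power_law.

(** * Three-valued random variables *)

Section orlicz_facts.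
Context (R : realType) (Phi : R -> R).
Hypothesis Phi_orlicz : generalized_orlicz Phi.
Hypothesis Phi_continuous : {within `[0, +oo[, continuous Phi}.
Hypothesis Phi_increasing : {in `[0, +oo[ &, {homo Phi : x y / x < y}}.

(** Composing with [pos_part] extends [Phi] from the half-line by the constant [Phi 0], so that
    results about functions on the whole line apply. *)
Lemma orlicz_ext_nondecreasing :
  {homo (fun x => Phi (pos_part x)) : x y / x <= y}.
Proof.
move=> x y xy; apply: (gorlicz_nondecreasing Phi_orlicz).
- by rewrite in_itv/= andbT le_max lexx orbT.
- by rewrite in_itv/= andbT le_max lexx orbT.
by rewrite ge_max !le_max xy lexx orbT.
Qed.

Lemma orlicz_ext_continuous : continuous (fun x => Phi (pos_part x)).
Proof.
have /subspace_continuousP Phi_c := Phi_continuous.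
have pos0 x : 0 <= pos_part x :> R by rewrite le_max lexx orbT.
move=> x; apply: (@cvg_comp _ _ _ (@pos_part R) Phi _
    (within [set` `[0, +oo[] (nbhs (pos_part x)))); last first.
  by apply: Phi_c; rewrite /= in_itv/= pos0.
have pos_c : pos_part y @[y --> x] --> pos_part x.
  apply: (@continuous_max _ _ id (cst 0)); first exact: cvg_id.
  exact: cst_continuous.
move=> S /pos_c; apply: (filterS (F := nbhs x)) => y /=; apply.
by rewrite in_itv/= pos0.
Qed.

Lemma orlicz_lt (x y : R) : 0 <= x -> x < y -> Phi x < Phi y.
Proof.
move=> x0 xy; apply: Phi_increasing => //.
- by rewrite in_itv/= x0.
- by rewrite in_itv/= (le_trans x0)// ltW.
Qed.

Lemma orlicz_le (x y : R) : 0 <= x -> x <= y -> Phi x <= Phi y.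
Proof.
move=> x0; rewrite le_eqVlt => /predU1P[->//|xy].
exact/ltW/orlicz_lt.
Qed.

End orlicz_facts.

Section three_valued.
Context d (T : measurableType d) (R : realType) (P : probability T R).
Context (A B : set T) (mA : measurable A) (mB : measurable B).
Implicit Types (x y z : R).

(** The measurability proofs are arguments so that the measurable-function instance declared below
    is found from the term alone, which makes it usable as a random variable. *)
Definition three_valued of measurable A & measurable B := fun (x y z : R) (w : T) =>
  if w \in A then x else if w \in B then y else z.

Local Notation X := (three_valued mA mB).

Lemma three_valued_comp (f : R -> R) x y z w :
  f (X x y z w) = X (f x) (f y) (f z) w.
Proof. by rewrite /three_valued; case: ifP => // _; case: ifP. Qed.

Lemma three_valuedD x y z x' y' z' w :
  X x y z w + X x' y' z' w = X (x + x') (y + y') (z + z') w.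
Proof. by rewrite /three_valued; case: ifP => // _; case: ifP. Qed.

Lemma three_valued_ge0 x y z w : 0 <= x -> 0 <= y -> 0 <= z -> 0 <= X x y z w.
Proof. by rewrite /three_valued; case: ifP => // _; case: ifP. Qed.

Lemma measurable_three_valued x y z : measurable_fun setT (X x y z).
Proof.
have m_in C : measurable C -> measurable_fun setT (fun w : T => w \in C).
  move=> mC; apply: (@measurable_fun_bool _ _ _ _ true).
  rewrite setTI [X in measurable X](_ : _ = C)//.
  by apply/seteqP; split=> w /=; [exact: set_mem | exact: mem_set].
apply: measurable_fun_ifT => //; first exact: m_in.
by apply: measurable_fun_ifT => //; exact: m_in.
Qed.

HB.instance Definition _ x y z :=
  @isMeasurableFun.Build _ _ _ _ (X x y z) (measurable_three_valued x y z).

Lemma expectation_three_valued x y z : [disjoint A & B] ->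
  0 <= x -> 0 <= y -> 0 <= z ->
  ('E_P[X x y z] = (fine (P A) * x + fine (P B) * y +
                   (1 - fine (P A) - fine (P B)) * z)%:E)%E.
Proof.
move=> /eqP AB x0 y0 z0; rewrite unlock.
have mC : measurable (~` (A `|` B)) by apply/measurableC/measurableU.
have XE w : (X x y z w)%:E = (x%:E * (\1_A w)%:E + y%:E * (\1_B w)%:E
    + z%:E * (\1_(~` (A `|` B)) w)%:E)%E.
  rewrite -!EFinM -!EFinD; congr EFin.
  rewrite /three_valued !indicE in_setC in_setU.
  have [wA|wA] := pselect (A w); have [wB|wB] := pselect (B w).
  - by have : (A `&` B) w by []; rewrite AB.
  - by rewrite (mem_set wA) (memNset wB) /=; ring.
  - by rewrite (memNset wA) (mem_set wB) /=; ring.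
  - by rewrite (memNset wA) (memNset wB) /=; ring.
under eq_integral do rewrite XE.
have m1 C (r : R) : measurable C ->
    measurable_fun setT (fun w : T => (r%:E * (\1_C w)%:E)%E).
  move=> mD; apply: measurable_funeM; apply/measurable_EFinP.
  exact: measurable_indic.
have n1 C (r : R) w : 0 <= r -> (0 <= r%:E * (\1_C w : R)%:E)%E.
  by move=> r0; rewrite mule_ge0 ?lee_fin.
rewrite ge0_integralD//; last 4 first.
- by move=> w _; rewrite adde_ge0// n1.
- by apply: emeasurable_funD; exact: m1.
- by move=> w _; exact: n1.
- exact: m1.
rewrite ge0_integralD//; last 4 first.
- by move=> w _; exact: n1.
- exact: m1.
- by move=> w _; exact: n1.
- exact: m1.
have i1 C (r : R) : measurable C -> 0 <= r ->
    (\int[P]_w (r%:E * (\1_C w)%:E) = (fine (P C) * r)%:E)%E.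
  move=> mD r0; rewrite ge0_integralZl//.
  - by rewrite integral_indic// setIT EFinM fineK ?fin_num_measure// muleC.
  - by apply/measurable_EFinP; exact: measurable_indic.
rewrite !i1// -!EFinD probability_setC//; last exact: measurableU.
rewrite measureU// fineB//; last by rewrite fin_numD !fin_num_measure.
rewrite fineD ?fin_num_measure//=; congr EFin; ring.
Qed.
End three_valued.

Section continuity.
Context (R : realType) (Phi : R -> R).
Hypothesis Phi_orlicz : generalized_orlicz Phi.
Hypothesis Phi_continuous : {within `[0, +oo[, continuous Phi}.

Lemma orlicz_scale_cvg (x k0 : R) : 0 <= x -> 0 < k0 ->
  Phi (x / k) @[k --> k0] --> Phi (x / k0).
Proof.
move=> x0 k00; have E k : 0 < k -> Phi (pos_part (x / k)) = Phi (x / k).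
  by move=> ?; rewrite /pos_part max_l// divr_ge0// ltW.
rewrite -E//.
have c : Phi (pos_part (x / k)) @[k --> k0] --> Phi (pos_part (x / k0)).
  apply: (@cvg_comp _ _ _ (fun k => x / k) (fun y => Phi (pos_part y))
      _ (nbhs (x / k0))); last exact: orlicz_ext_continuous.
  by apply: cvgMr; apply: cvgV; [rewrite gt_eqF | exact: cvg_id].
apply: cvg_trans c; apply: near_eq_cvg; near=> k; apply: E.
by near: k; exact: lt_nbhsr.
Unshelve. all: end_near. Qed.

(** The axioms give only [Phi 1 <= 1]. The reverse inequality is the limit of Phi (1 / k) > 1 as k
    increases to 1, that is, as the argument decreases to 1. *)
Lemma orlicz_at1 : Phi 1 = 1.
Proof.
apply/eqP; rewrite eq_le (gorlicz_le1 Phi_orlicz) ?ler01 ?lexx //=.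
have := @orlicz_scale_cvg 1 1 ler01 ltr01; rewrite divr1 => /cvg_at_left_filter cvh.
rewrite -(cvg_lim (@Rhausdorff R) cvh); apply: limr_ge (cvgP _ cvh) _.
near=> k; apply/ltW/(gorlicz_gt1 Phi_orlicz); rewrite div1r invf_gt1//.
Unshelve. all: end_near. Qed.
End continuity.

(** * The Orlicz premium of a three-valued variable *)

Section three_valued_premium.
Context d (T : measurableType d) (R : realType) (P : probability T R).
Context (Phi : R -> R).
Hypothesis Phi_orlicz : generalized_orlicz Phi.
Hypothesis Phi_continuous : {within `[0, +oo[, continuous Phi}.
Hypothesis Phi_increasing : {in `[0, +oo[ &, {homo Phi : x y / x < y}}.
Context (A B : set T) (mA : measurable A) (mB : measurable B).
Hypothesis AB : [disjoint A & B].
Context (x y z : R) (x0 : 0 <= x) (y0 : 0 <= y) (z0 : 0 <= z).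

Local Notation X := (three_valued mA mB x y z).
Let a := fine (P A).
Let b := fine (P B).
(** Closed form of E[Phi(X / k)]. It is nonincreasing and continuous in k > 0, so comparing the
    premium with k amounts to comparing [h k] with 1. *)
Let h k := a * Phi (x / k) + b * Phi (y / k) + (1 - a - b) * Phi (z / k).

Let a0 : 0 <= a. Proof. by rewrite fine_ge0. Qed.
Let b0 : 0 <= b. Proof. by rewrite fine_ge0. Qed.
Let c0 : 0 <= 1 - a - b.
Proof.
have mAB := measurableU _ _ mA mB; have /eqP AB0 := AB.
have : fine (P (A `|` B)) <= 1.
  by rewrite -lee_fin fineK ?fin_num_measure// probability_le1.
rewrite measureU// fineD ?fin_num_measure// -/a -/b; lra.
Qed.

Let Phi_le := orlicz_le Phi_increasing.
Let Phi_ge0 := gorlicz_ge0 Phi_orlicz.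

Let scale_le (u k k' : R) : 0 <= u -> 0 < k -> k <= k' ->
  Phi (u / k') <= Phi (u / k).
Proof.
move=> u0 k0 kk'; apply: Phi_le; first by rewrite divr_ge0// ltW// (lt_le_trans k0).
by rewrite ler_wpM2l// lef_pV2// posrE// (lt_le_trans k0).
Qed.

Lemma expectation_orlicz_three_valued (k : R) : 0 < k ->
  ('E_P[fun w => Phi (X w / k)%R] = (h k)%:E)%E.
Proof.
move=> k0; rewrite -expectation_three_valued//;
  try by apply: Phi_ge0; rewrite divr_ge0// ltW.
congr expectation; apply/funext => w.
by rewrite (three_valued_comp mA mB (fun t => Phi (t / k))).
Qed.

Let h_le (k k' : R) : 0 < k -> k <= k' -> h k' <= h k.
Proof. by move=> k0 kk'; rewrite !lerD// ler_wpM2l// scale_le. Qed.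

Let h_cvg (k0 : R) : 0 < k0 -> h k @[k --> k0] --> h k0.
Proof.
by move=> k00; apply: cvgD; [apply: cvgD|]; apply: cvgMr; exact: orlicz_scale_cvg.
Qed.

(** A feasible value exists below every k' > k, so h k' <= 1 by monotonicity. Letting k' decrease to
    k avoids asking whether the infimum is attained. *)
Lemma premium_three_valued_le (k : R) : 0 < k ->
  (orlicz_premium P Phi X <= k%:E)%E -> h k <= 1.
Proof.
move=> k0 Hk.
have := h_cvg k0 => /cvg_at_right_filter cvh.
rewrite -(cvg_lim (@Rhausdorff R) cvh); apply: limr_le (cvgP _ cvh) _.
near=> k'.
have kk' : k < k' by near: k'; exact: nbhs_right_gt.
have := le_lt_trans Hk; move=> /(_ k'%:E); rewrite lte_fin => /(_ kk').
move=> /ereal_inf_lt[_ [q [q0 +] <-]]; rewrite lte_fin => + qk'.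
rewrite expectation_orlicz_three_valued// lee_fin; apply: le_trans.
by apply: h_le => //; exact: ltW.
Unshelve. all: end_near. Qed.

Lemma premium_three_valued_ge (k : R) : 0 < k ->
  (k%:E <= orlicz_premium P Phi X)%E -> 1 <= h k.
Proof.
move=> k0 Hk.
have := h_cvg k0 => /cvg_at_left_filter cvh.
rewrite -(cvg_lim (@Rhausdorff R) cvh); apply: limr_ge (cvgP _ cvh) _.
near=> k'.
have kk' : k' < k by near: k'; exact: nbhs_left_lt.
have k'0 : 0 < k' by near: k'; exact: nbhs_left_gt.
rewrite leNgt; apply/negP => hk'.
have : (orlicz_premium P Phi X <= k'%:E)%E.
  apply: ereal_inf_lbound; exists k' => //; split => //.
  by rewrite expectation_orlicz_three_valued// lee_fin ltW.
by move=> /(le_trans Hk); rewrite lee_fin leNgt kk'.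
Unshelve. all: end_near. Qed.

(** If some q < k were feasible, then h q <= 1 = h k, and termwise monotonicity would force equality
    in each term. Strict monotonicity allows this only where the weight or the value is 0, so that h
    k = Phi 0 < 1, a contradiction. *)
Lemma premium_three_valued (k : R) : 0 < k -> h k = 1 ->
  orlicz_premium P Phi X = k%:E.
Proof.
move=> k0 hk; apply/eqP; rewrite eq_le; apply/andP; split.
  apply: ereal_inf_lbound; exists k => //; split => //.
  by rewrite expectation_orlicz_three_valued// hk.
apply: le_ereal_inf_tmp => _ [q [q0 +] <-].
rewrite expectation_orlicz_three_valued// !lee_fin => hq.
rewrite leNgt; apply/negP => qk.
have strict (c u : R) : 0 <= c -> 0 <= u -> c * Phi (u / k) <= c * Phi (u / q) /\
   (c * Phi (u / q) <= c * Phi (u / k) -> c * Phi (u / k) = c * Phi 0).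
  move=> c_ge0 u0; split; first by rewrite ler_wpM2l// scale_le// ltW.
  move: c_ge0; rewrite le_eqVlt => /predU1P[<-|c_gt0]; first by rewrite !mul0r.
  move: u0; rewrite le_eqVlt => /predU1P[<-|u_gt0]; first by rewrite !mul0r.
  rewrite ler_pM2l// leNgt (orlicz_lt Phi_increasing)//.
    by rewrite divr_ge0// ltW.
  by rewrite ltr_pM2l// ltf_pV2.
have [s1 e1] := strict a x a0 x0; have [s2 e2] := strict b y b0 y0.
have [s3 e3] := strict _ z c0 z0.
have : Phi 0 < Phi 1 by apply: orlicz_lt => //; exact: ltr01.
rewrite orlicz_at1//; move: hk hq; rewrite /h => hk hq.
have {}e1 := e1 ltac:(lra); have {}e2 := e2 ltac:(lra).
have {}e3 := e3 ltac:(lra).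
move: hk; rewrite e1 e2 e3 => hk; have -> : Phi 0 = 1 by rewrite -hk; ring.
by rewrite ltxx.
Qed.

Lemma three_valued_orlicz_space : h 1 <= 1 -> orlicz_space_ge0 P Phi X.
Proof.
move=> h1; split; last by apply: aeW => w; rewrite three_valued_ge0.
exists 1; first exact: ltr01.
rewrite (_ : (fun w => _) = fun w => Phi (X w / 1)).
  by rewrite expectation_orlicz_three_valued// lee_fin.
by apply/funext => w; rewrite ger0_norm// three_valued_ge0.
Qed.
End three_valued_premium.

(** * Necessity *)

Section necessity.
Context d (T : measurableType d) (R : realType) (P : probability T R).
Context (Phi : R -> R).
Hypothesis P_nonatomic : nonatomic P.
Hypothesis Phi_orlicz : generalized_orlicz Phi.
Hypothesis Phi_continuous : {within `[0, +oo[, continuous Phi}.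
Hypothesis Phi_increasing : {in `[0, +oo[ &, {homo Phi : x y / x < y}}.

Let Phi1 : Phi 1 = 1 := orlicz_at1 Phi_orlicz Phi_continuous.
Let Phi_lt := orlicz_lt Phi_increasing.

Lemma exists_disjoint_measures (a b : R) : 0 <= a -> 0 <= b -> a + b <= 1 ->
  exists A B, [/\ measurable A, measurable B, [disjoint A & B],
    fine (P A) = a & fine (P B) = b].
Proof.
move=> a0 b0 ab.
have [|A [mA _ PA]] := nonatomic_subset P_nonatomic measurableT (a := a).
  by rewrite a0 probability_setT/=; lra.
have mCA := measurableC mA.
have [|B [mB BA PB]] := nonatomic_subset P_nonatomic mCA (a := b).
  by rewrite b0 probability_setC// fineB ?fin_num_measure//= PA; lra.
exists A, B; split => //.
by apply/eqP/seteqP; split => // w [Aw /BA].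
Qed.

Lemma cash_additive_scaling : cash_additive P Phi ->
  forall t s l : R, 0 < t -> -1 <= s < 0 -> 0 < l <= 1 ->
  (Phi (1 + l * t) - 1) * (Phi (1 + s) - 1) =
  (Phi (1 + l * s) - 1) * (Phi (1 + t) - 1).
Proof.
move=> cashP t s l t0 /andP[s1 s0] /andP[l0 l1].
have gt : 1 < Phi (1 + t) by apply: (gorlicz_gt1 Phi_orlicz); lra.
have gs : Phi (1 + s) < 1 by rewrite -[ltRHS]Phi1; apply: Phi_lt; lra.
have D0 : 0 < Phi (1 + t) - Phi (1 + s) by lra.
(* This weight on the value 1 + s makes E[Phi(X)] = 1 when 1 + t has weight 1 - a. The second event
   is taken null, so X is really two-valued. *)
pose a := (Phi (1 + t) - 1) / (Phi (1 + t) - Phi (1 + s)).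
have aE : a * Phi (1 + s) + (1 - a) * Phi (1 + t) = 1.
  by rewrite /a; field; rewrite gt_eqF.
have [|||A [B [mA mB AB PA PB]]] := @exists_disjoint_measures a 0.
- by rewrite divr_ge0//; lra.
- by [].
- by rewrite addr0 ler_pdivrMr//; lra.
(* With this c, dividing by 1 + c is multiplying by l, and (1 + s + c) l = 1 + l s. *)
pose c := l^-1 - 1.
have c0 : 0 <= c by rewrite subr_ge0 invf_ge1.
have lc : l^-1 = 1 + c by rewrite /c; ring.
pose X := three_valued mA mB (1 + s) 0 (1 + t).
have s1' : 0 <= 1 + s by lra.
have t1' : 0 <= 1 + t by lra.
have HX : orlicz_premium P Phi X = 1%:E.
  apply: premium_three_valued => //.
  by rewrite !divr1 PA PB mul0r addr0 subr0.
have spX : orlicz_space_ge0 P Phi X.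
  apply: three_valued_orlicz_space => //.
  by rewrite !divr1 PA PB mul0r addr0 subr0 aE.
have := cashP X spX c c0; rewrite HX.
rewrite (_ : (fun w => X w + c) =
  three_valued mA mB (1 + s + c) c (1 + t + c)); last first.
  apply/funext => w; rewrite (three_valued_comp mA mB (fun u => u + c)).
  by rewrite add0r.
rewrite -EFinD -lc => HXc.
have l'0 : 0 < l^-1 by rewrite invr_gt0.
have sc0 : 0 <= 1 + s + c by lra.
have tc0 : 0 <= 1 + t + c by lra.
have h1 : a * Phi (1 + l * s) + (1 - a) * Phi (1 + l * t) <= 1.
  have := @premium_three_valued_le _ _ _ P _ Phi_orlicz Phi_continuous
    Phi_increasing _ _ mA mB AB _ _ _ sc0 c0 tc0 _ l'0.
  rewrite HXc lexx => /(_ erefl); rewrite PA PB mul0r addr0 subr0 invrK.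
  rewrite /c (_ : (1 + s + _) * l = 1 + l * s); last by field; rewrite gt_eqF.
  by rewrite (_ : (1 + t + _) * l = 1 + l * t)//; field; rewrite gt_eqF.
have h2 : 1 <= a * Phi (1 + l * s) + (1 - a) * Phi (1 + l * t).
  have := @premium_three_valued_ge _ _ _ P _ Phi_orlicz Phi_continuous
    _ _ mA mB AB _ _ _ sc0 c0 tc0 _ l'0.
  rewrite HXc lexx => /(_ erefl); rewrite PA PB mul0r addr0 subr0 invrK.
  rewrite /c (_ : (1 + s + _) * l = 1 + l * s); last by field; rewrite gt_eqF.
  by rewrite (_ : (1 + t + _) * l = 1 + l * t)//; field; rewrite gt_eqF.
have {h1 h2} h : a * (Phi (1 + l * s) - 1) + (1 - a) * (Phi (1 + l * t) - 1) = 0.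
  by apply/eqP; rewrite eq_le; apply/andP; split; lra.
(* Substituting the value of a into the balance [h] and clearing its denominator gives the
   identity. *)
apply/eqP; rewrite -subr_eq0; apply/eqP.
transitivity (- (Phi (1 + t) - Phi (1 + s)) *
  (a * (Phi (1 + l * s) - 1) + (1 - a) * (Phi (1 + l * t) - 1))).
  by rewrite /a; field; rewrite gt_eqF.
by rewrite h mulr0.
Qed.

Lemma cash_additive_power : cash_additive P Phi ->
  exists alpha p : R, [/\ 0 < alpha < 1, 0 < p &
    orlicz_equiv Phi (Lp_quantile_orlicz alpha p)].
Proof.
move=> /cash_additive_scaling gM.
pose g t := Phi (1 + t) - 1.
have g_gt0 t : 0 < t -> 0 < g t.
  by move=> t0; rewrite subr_gt0; apply: (gorlicz_gt1 Phi_orlicz); lra.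
have g_lt0 s : -1 <= s < 0 -> g s < 0.
  by move=> /andP[? ?]; rewrite subr_lt0 -[ltRHS]Phi1; apply: Phi_lt; lra.
have g_lt t s : 0 < t < s -> g t < g s.
  by move=> /andP[? ?]; rewrite ltrD2r; apply: Phi_lt; lra.
have [p p0 [gpos gneg]] := @power_law _ g gM g_gt0 g_lt0 g_lt.
have g1 : 0 < g 1 by exact: g_gt0.
have gN1 : g (-1) < 0 by apply: g_lt0; rewrite lexx ltrN10.
have D0 : 0 < g 1 - g (-1) by lra.
(* The weights alpha and 1 - alpha must be in the ratio of g 1 to - g (-1); normalising their sum to
   1 fixes both alpha and the equivalence constant. *)
exists (g 1 / (g 1 - g (-1))), p; split=> //.
  by rewrite divr_gt0//= ltr_pdivrMr//; lra.
exists (g 1 - g (-1))^-1; first by rewrite invr_gt0.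
move=> x x0; rewrite (_ : Phi x - 1 = g (x - 1)); last first.
  by rewrite /g; congr (Phi _ - 1); ring.
rewrite /Lp_quantile_orlicz /pos_part /neg_part.
have [x1|x1] := ltrP 1 x.
  rewrite max_l; last by lra.
  rewrite max_r; last by lra.
  rewrite (gpos (x - 1)); last by lra.
  by rewrite powR0 ?gt_eqF//; field; rewrite gt_eqF.
rewrite max_r; last by lra.
rewrite max_l; last by lra.
move: x1; rewrite le_eqVlt => /predU1P[->|x1].
  by rewrite subrr oppr0 powR0 ?gt_eqF// /g addr0 Phi1; ring.
have -> : g (x - 1) = g (-1) * (- (x - 1)) `^ p.
  by rewrite -gneg ?opprK//; apply/andP; split; lra.
by rewrite powR0 ?gt_eqF//; field; rewrite gt_eqF.
Qed.

(* X and Y exchange u and v on two events of mass a and share a value z that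
   balances E[Phi(X)] = 1; z drops out when Z = (X + Y) / 2 is compared. *)
Lemma midpoint_three_valued (u v : R) : 0 <= u -> 0 <= v ->
  exists X Y Z : {RV P >-> R},
  [/\ orlicz_space_ge0 P Phi X /\ orlicz_premium P Phi X = 1%:E,
      orlicz_space_ge0 P Phi Y /\ orlicz_premium P Phi Y = 1%:E,
      (fun w => 1 / 2 * X w + (1 - 1 / 2) * Y w) = Z,
      (orlicz_premium P Phi Z <= 1%:E)%E ->
        Phi ((u + v) / 2) <= (Phi u + Phi v) / 2 &
      (1%:E <= orlicz_premium P Phi Z)%E ->
        (Phi u + Phi v) / 2 <= Phi ((u + v) / 2)].
Proof.
move=> u0 v0; pose S := Phi u + Phi v - 2.
have Phi0 : Phi 0 < 1 by rewrite -[ltRHS]Phi1; apply: Phi_lt => //; exact: ltr01.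
have Phi2 : 1 < Phi 2 by apply: (gorlicz_gt1 Phi_orlicz); lra.
have [z [a [z0 a0 a2 balance]]] : exists z a, [/\ 0 <= z, 0 < a, a <= 1 / 2 &
    a * S + (1 - 2 * a) * (Phi z - 1) = 0].
  (* [w z] solves the balance equation for the mass. Choosing z on the side of 1 opposite to the
     sign of S makes it positive and at most 1/2, so that two disjoint events of this mass fit. If S
     = 0, mass 1/2 leaves no room for z. *)
  pose w z := (Phi z - 1) / (2 * (Phi z - 1) - S).
  have wE z : 2 * (Phi z - 1) - S != 0 ->
      w z * S + (1 - 2 * w z) * (Phi z - 1) = 0.
    by move=> ?; rewrite /w; field.
  have [S0|S0|S0] := ltrgt0P S.
  - exists 0, (w 0); split => //.
    + by rewrite /w -mulrNN -invrN divr_gt0//; lra.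
    + by rewrite /w -mulrNN -invrN ler_pdivrMr; lra.
    + by apply: wE; rewrite lt_eqF//; lra.
  - exists 2, (w 2); split => //.
    + by rewrite /w divr_gt0//; lra.
    + by rewrite /w ler_pdivrMr; lra.
    + by apply: wE; rewrite gt_eqF//; lra.
  - exists 1, (1 / 2); split => //; first by lra.
have [|||A [B [mA mB AB PA PB]]] := @exists_disjoint_measures a a; try lra.
have m0 : 0 <= (u + v) / 2 by lra.
have hXY : a * Phi u + a * Phi v + (1 - a - a) * Phi z = 1.
  by move: balance; rewrite /S; lra.
exists (three_valued mA mB u v z), (three_valued mA mB v u z),
  (three_valued mA mB ((u + v) / 2) ((u + v) / 2) z).
split.
- split; first by apply: three_valued_orlicz_space => //; rewrite !divr1 PA PB hXY.
  by apply: premium_three_valued => //; rewrite !divr1 PA PB hXY.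
- have {}hXY : a * Phi v + a * Phi u + (1 - a - a) * Phi z = 1 by lra.
  split; first by apply: three_valued_orlicz_space => //; rewrite !divr1 PA PB hXY.
  by apply: premium_three_valued => //; rewrite !divr1 PA PB hXY.
- apply/funext => w.
  rewrite (three_valued_comp mA mB (fun t => 1 / 2 * t)).
  rewrite (three_valued_comp mA mB (fun t => (1 - 1 / 2) * t)) three_valuedD.
  by congr three_valued; lra.
- move=> /premium_three_valued_le; rewrite !divr1 PA PB => h.
  have {}h := h Phi_orlicz Phi_continuous Phi_increasing AB m0 m0 z0 ltr01.
  have : a * (Phi ((u + v) / 2) * 2) <= a * (Phi u + Phi v) by lra.
  by rewrite ler_pM2l//; lra.
- move=> /premium_three_valued_ge; rewrite !divr1 PA PB => h.
  have {}h := h Phi_orlicz Phi_continuous AB m0 m0 z0 ltr01.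
  have : a * (Phi u + Phi v) <= a * (Phi ((u + v) / 2) * 2) by lra.
  by rewrite ler_pM2l//; lra.
Qed.

Lemma convex_midpoint : premium_convex P Phi ->
  forall u v, 0 <= u -> 0 <= v -> Phi ((u + v) / 2) <= (Phi u + Phi v) / 2.
Proof.
move=> cvxP u v u0 v0.
have [X [Y [Z [[spX HX] [spY HY] XYZ + _]]]] := midpoint_three_valued u0 v0.
apply; rewrite -XYZ; apply: le_trans (cvxP X Y spX spY (1 / 2) _) _; first by lra.
by rewrite HX HY !mule1 -EFinD lee_fin; lra.
Qed.

Lemma concave_midpoint : premium_concave P Phi ->
  forall u v, 0 <= u -> 0 <= v -> (Phi u + Phi v) / 2 <= Phi ((u + v) / 2).
Proof.
move=> cvxP u v u0 v0.
have [X [Y [Z [[spX HX] [spY HY] XYZ _]]]] := midpoint_three_valued u0 v0.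
apply; rewrite -XYZ; apply: le_trans (cvxP X Y spX spY (1 / 2) _); last by lra.
by rewrite HX HY !mule1 -EFinD lee_fin; lra.
Qed.
End necessity.

(** * The exponent and the weight forced by the midpoint inequalities *)

Section exponent.
Context (R : realType) (Phi : R -> R) (alpha p : R).
Hypothesis alpha01 : 0 < alpha < 1.
Hypothesis p0 : 0 < p.
Hypothesis Phi_equiv : orlicz_equiv Phi (Lp_quantile_orlicz alpha p).

Let powR2_eq (q : R) : 2 `^ q = 2 -> q = 1.
Proof.
have ln2 : 0 < ln 2 :> R by rewrite ln_gt0// ltr1n.
rewrite /powR pnatr_eq0/= => /(congr1 (@ln R)); rewrite expRK => h.
by apply: (mulIf (lt0r_neq0 ln2)); rewrite h mul1r.
Qed.

Let values : exists2 c : R, 0 < c &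
  [/\ Phi 0 = 1 - c * (1 - alpha), Phi (1 / 2) = 1 - c * ((1 - alpha) / 2 `^ p),
      Phi 1 = 1, Phi 2 = 1 + c * alpha & Phi 3 = 1 + c * (alpha * 2 `^ p)].
Proof.
case: Phi_equiv => c c0 cE; exists c^-1; first by rewrite invr_gt0.
have val x y : 0 <= x -> Lp_quantile_orlicz alpha p x = 1 + y ->
    Phi x = 1 + c^-1 * y.
  move=> x0; rewrite cE// => /addrI <-; rewrite mulKf ?gt_eqF//; lra.
have pp x : 0 <= x -> pos_part x = x /\ neg_part x = 0 :> R.
  by move=> x0; rewrite /pos_part /neg_part max_l// max_r//; lra.
have np x : x <= 0 -> pos_part x = 0 /\ neg_part x = - x :> R.
  by move=> x0; rewrite /pos_part /neg_part max_r// max_l//; lra.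
have p00 : 0 `^ p = 0 :> R by rewrite powR0// gt_eqF.
have half_powR : 2^-1 `^ p = (2 `^ p)^-1 :> R.
  have t0 : 2 `^ p != 0 :> R by rewrite gt_eqF// powR_gt0.
  apply: (mulIf t0); rewrite mulVf// -powRM ?invr_ge0// mulVf ?pnatr_eq0//.
  by rewrite powR1.
rewrite -!mulrN; split.
- apply: val => //; have [|h1 h2] := np (0 - 1); first lra.
  by rewrite /Lp_quantile_orlicz h1 h2 p00 sub0r opprK powR1; lra.
- apply: val; first lra; have [|h1 h2] := np (1 / 2 - 1); first lra.
  rewrite /Lp_quantile_orlicz h1 h2 p00 (_ : - (1 / 2 - 1) = 2^-1); last lra.
  by rewrite half_powR; lra.
- rewrite -[RHS]addr0 -(mulr0 c^-1); apply: val; first lra.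
  have [|h1 h2] := pp (1 - 1); first lra.
  by rewrite /Lp_quantile_orlicz h1 h2 subrr p00; lra.
- apply: val; first lra; have [|h1 h2] := pp (2 - 1); first lra.
  rewrite /Lp_quantile_orlicz h1 h2 p00 (_ : 2 - 1 = 1); last lra.
  by rewrite powR1; lra.
- apply: val; first lra; have [|h1 h2] := pp (3 - 1); first lra.
  rewrite /Lp_quantile_orlicz h1 h2 p00 (_ : 3 - 1 = 2); lra.
Qed.

(** The pair (1, 3), to the right of 1, gives 2^p >= 2; the pair (0, 1), to its left, gives 2^p <=
    2; the pair (0, 2), straddling 1, compares alpha with 1 - alpha. *)
Lemma midpoint_convex_exponent :
  (forall u v, 0 <= u -> 0 <= v -> Phi ((u + v) / 2) <= (Phi u + Phi v) / 2) ->
  p = 1 /\ 1 / 2 <= alpha.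
Proof.
have [c c0 [e0 e12 e1 e2 e3]] := values; have /andP[a0 a1] := alpha01.
have t0 : 0 < 2 `^ p :> R by rewrite powR_gt0.
move=> mid; have := mid 1 3 ler01 (ler0n _ _); have := mid 0 1 (lexx _) ler01.
have := mid 0 2 (lexx _) (ler0n _ _).
rewrite !add0r (_ : (1 + 3) / 2 = 2); last lra.
rewrite (_ : 2 / 2 = 1 :> R); last lra.
rewrite e0 e12 e1 e2 e3 => h1 h2 h3.
have tinv : 2 `^ p * (2 `^ p)^-1 = 1 by rewrite mulfV// gt_eqF.
have {}h1 : 1 / 2 <= alpha.
  have : c * (1 - 2 * alpha) <= 0 by lra.
  by rewrite pmulr_rle0//; lra.
have {}h3 : 2 <= 2 `^ p.
  have : c * alpha * (2 - 2 `^ p) <= 0 by lra.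
  by rewrite pmulr_rle0 ?mulr_gt0//; lra.
have {}h2 : 2 `^ p <= 2.
  have : c * (1 - alpha) * (1 / 2 - (2 `^ p)^-1) <= 0 by lra.
  by rewrite pmulr_rle0 ?mulr_gt0 ?subr_gt0//; nra.
by split=> //; apply: powR2_eq; lra.
Qed.

Lemma midpoint_concave_exponent :
  (forall u v, 0 <= u -> 0 <= v -> (Phi u + Phi v) / 2 <= Phi ((u + v) / 2)) ->
  p = 1 /\ alpha <= 1 / 2.
Proof.
have [c c0 [e0 e12 e1 e2 e3]] := values; have /andP[a0 a1] := alpha01.
have t0 : 0 < 2 `^ p :> R by rewrite powR_gt0.
move=> mid; have := mid 1 3 ler01 (ler0n _ _); have := mid 0 1 (lexx _) ler01.
have := mid 0 2 (lexx _) (ler0n _ _).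
rewrite !add0r (_ : (1 + 3) / 2 = 2); last lra.
rewrite (_ : 2 / 2 = 1 :> R); last lra.
rewrite e0 e12 e1 e2 e3 => h1 h2 h3.
have tinv : 2 `^ p * (2 `^ p)^-1 = 1 by rewrite mulfV// gt_eqF.
have {}h1 : alpha <= 1 / 2.
  have : c * (2 * alpha - 1) <= 0 by lra.
  by rewrite pmulr_rle0//; lra.
have {}h3 : 2 `^ p <= 2.
  have : c * alpha * (2 `^ p - 2) <= 0 by lra.
  by rewrite pmulr_rle0 ?mulr_gt0//; lra.
have {}h2 : 2 <= 2 `^ p.
  have : c * (1 - alpha) * ((2 `^ p)^-1 - 1 / 2) <= 0 by lra.
  by rewrite pmulr_rle0 ?mulr_gt0 ?subr_gt0//; nra.
by split=> //; apply: powR2_eq; lra.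
Qed.
End exponent.

(** * Sufficiency *)

Section expectation_facts.
Context d (T : measurableType d) (R : realType) (P : probability T R).

(** Used to replace an almost surely nonnegative X by [pos_part X], which is nonnegative everywhere
    and keeps [Phi] on the half-line where it is controlled. *)
Lemma orlicz_premium_ae_eq (Phi : R -> R) (X Y : T -> R) :
  (\forall w \ae P, X w = Y w) -> orlicz_premium P Phi X = orlicz_premium P Phi Y.
Proof.
move=> XY.
have E k : ('E_P[fun w => Phi (X w / k)%R] =
            'E_P[fun w => Phi (Y w / k)%R])%E.
  by apply: expectation_ae_eq; move: XY; apply: filterS => w ->.
by congr ereal_inf; congr image; apply/funext => k; rewrite /= E.
Qed.

Lemma Lp_quantile_ae_eq (alpha p : R) (X Y : T -> R) :
  (\forall w \ae P, X w = Y w) ->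
  Lp_quantile P alpha p X = Lp_quantile P alpha p Y.
Proof.
move=> XY.
have E k (f : R -> R) : ('E_P[fun w => f (X w - k)%R] =
                         'E_P[fun w => f (Y w - k)%R])%E.
  by apply: expectation_ae_eq; move: XY; apply: filterS => w ->.
congr ereal_inf; congr image; apply/funext => k /=.
by rewrite (E k (fun x => pos_part x `^ p)) (E k (fun x => neg_part x `^ p)).
Qed.

Lemma ae_eq_pos_part (X : T -> R) : (\forall w \ae P, 0 <= X w) ->
  \forall w \ae P, X w = pos_part (X w).
Proof. by apply: filterS => w X0; rewrite /pos_part max_l. Qed.

Lemma pos_part_ge0 (x : R) : 0 <= pos_part x.
Proof. by rewrite /pos_part le_max lexx orbT. Qed.

Lemma neg_part_ge0 (x : R) : 0 <= neg_part x.
Proof. by rewrite /neg_part le_max lexx orbT. Qed.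

Lemma measurable_pos_part (X : T -> R) :
  measurable_fun setT X -> measurable_fun setT (fun w => pos_part (X w)).
Proof. by move=> mX; apply: measurable_maxr => //; exact: measurable_cst. Qed.

Lemma measurable_neg_part (X : T -> R) :
  measurable_fun setT X -> measurable_fun setT (fun w => neg_part (X w)).
Proof.
move=> mX; apply: measurable_maxr; last exact: measurable_cst.
exact: measurableT_comp.
Qed.

Lemma ge0_expectationD (f g : T -> R) :
  measurable_fun setT f -> measurable_fun setT g ->
  (forall w, 0 <= f w) -> (forall w, 0 <= g w) ->
  ('E_P[fun w => f w + g w]%R = 'E_P[f] + 'E_P[g])%E.
Proof.
move=> mf mg f0 g0; rewrite unlock; under eq_integral do rewrite EFinD.
rewrite ge0_integralD//.
- by move=> w _; rewrite lee_fin.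
- exact/measurable_EFinP.
- by move=> w _; rewrite lee_fin.
- exact/measurable_EFinP.
Qed.

Lemma ge0_expectationZl (f : T -> R) (k : R) :
  measurable_fun setT f -> (forall w, 0 <= f w) -> 0 <= k ->
  ('E_P[fun w => k * f w]%R = k%:E * 'E_P[f])%E.
Proof.
move=> mf f0 k0; rewrite unlock; under eq_integral do rewrite EFinM.
rewrite ge0_integralZl//; first exact/measurable_EFinP.
by move=> w _; rewrite lee_fin.
Qed.

Lemma ge0_expectation_le (f g : T -> R) :
  measurable_fun setT f -> measurable_fun setT g ->
  (forall w, 0 <= f w) -> (forall w, f w <= g w) ->
  ('E_P[f] <= 'E_P[g])%E.
Proof.
move=> mf mg f0 fg; rewrite unlock; apply: ge0_le_integral => //.
- by move=> w _; rewrite lee_fin.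
- exact/measurable_EFinP.
- exact/measurable_EFinP.
- by move=> w _; rewrite lee_fin.
Qed.
End expectation_facts.

Section sufficiency.
Context d (T : measurableType d) (R : realType) (P : probability T R).
Context (Phi : R -> R).
Hypothesis Phi_orlicz : generalized_orlicz Phi.
Implicit Types (X Y : T -> R) (k : R).

Let Phi_ge0 := gorlicz_ge0 Phi_orlicz.

Lemma measurable_orlicz X k : measurable_fun setT X -> (forall w, 0 <= X w) ->
  0 < k -> measurable_fun setT (fun w => Phi (X w / k)).
Proof.
move=> mX X0 k0.
rewrite (_ : (fun w => _) = (fun x => Phi (pos_part x)) \o (fun w => X w * k^-1)).
  apply: measurableT_comp; last exact: measurable_funM.
  apply: nondecreasing_measurable => //; exact: orlicz_ext_nondecreasing.
apply/funext => w /=; rewrite /pos_part max_l// divr_ge0//; exact: ltW.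
Qed.

(** * The premium as a quantile, and its translation invariance *)

Section quantile.
Context (alpha p : R).
Hypothesis alpha01 : 0 < alpha < 1.
Hypothesis p0 : 0 < p.
Hypothesis Phi_equiv : orlicz_equiv Phi (Lp_quantile_orlicz alpha p).

Let pos_pow X k := fun w => pos_part (X w - k) `^ p.
Let neg_pow X k := fun w => neg_part (X w - k) `^ p.

Let m_pos X k : measurable_fun setT X -> measurable_fun setT (pos_pow X k).
Proof.
move=> mX; apply: (measurableT_comp (measurable_powR p)).
by apply: measurable_pos_part; apply: measurable_funB.
Qed.

Let m_neg X k : measurable_fun setT X -> measurable_fun setT (neg_pow X k).
Proof.
move=> mX; apply: (measurableT_comp (measurable_powR p)).
by apply: measurable_neg_part; apply: measurable_funB.
Qed.

(** For X >= 0 the negative part of X - k is at most k. Finiteness is what permits cancelling this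
    term in the extended reals. *)
Lemma neg_part_moment_fin_num X k : measurable_fun setT X ->
  (forall w, 0 <= X w) -> 0 < k -> ('E_P[neg_pow X k] \is a fin_num)%E.
Proof.
move=> mX X0 k0; rewrite ge0_fin_numE; last first.
  by apply: expectation_ge0 => w; rewrite powR_ge0.
apply: (@le_lt_trans _ _ (k `^ p)%:E); last exact: ltry.
rewrite -(expectation_cst P (k `^ p)); apply: ge0_expectation_le => //.
- exact: m_neg.
- by move=> w; rewrite powR_ge0.
- move=> w; apply: ge0_ler_powR; rewrite ?nnegrE ?neg_part_ge0//; try exact: ltW.
  by rewrite /neg_part ge_max (ltW k0) andbT; have := X0 w; lra.
Qed.

(** By homogeneity of the power, (X / k - 1)^p is (X - k)^p / k^p on each side, whence the factor C.
    The negative term stands on the left so that all summands are nonnegative and expectations add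
    even when infinite. *)
Lemma orlicz_quantile_expectation X k : measurable_fun setT X ->
  (forall w, 0 <= X w) -> 0 < k -> exists2 C : R, 0 < C &
  ('E_P[fun w => Phi (X w / k)%R] + (C * (1 - alpha))%:E * 'E_P[neg_pow X k] =
   1 + (C * alpha)%:E * 'E_P[pos_pow X k])%E.
Proof.
have /andP[a0 a1] := alpha01.
move=> mX X0 k0; case: Phi_equiv => c c0 cE.
have kp0 : 0 < k `^ p by rewrite powR_gt0.
pose C := c^-1 * (k `^ p)^-1; have C0 : 0 < C by rewrite mulr_gt0 ?invr_gt0.
exists C => //.
have Ca0 : 0 <= C * alpha by rewrite mulr_ge0 ?ltW.
have Cb0 : 0 <= C * (1 - alpha) by rewrite mulr_ge0 ?subr_ge0 ?ltW.
have scale f : 0 <= f -> (f / k) `^ p = f `^ p * (k `^ p)^-1.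
  move=> f0; apply: (mulIf (lt0r_neq0 kp0)); rewrite -powRM ?divr_ge0 ?(ltW k0)//.
  by rewrite !divfK ?gt_eqF.
have point w : Phi (X w / k) + C * (1 - alpha) * neg_pow X k w =
    1 + C * alpha * pos_pow X k w.
  have Xk0 : 0 <= X w / k by rewrite divr_ge0 ?X0// ltW.
  have E : Phi (X w / k) = 1 + c^-1 * (Lp_quantile_orlicz alpha p (X w / k) - 1).
    by rewrite cE//; field; rewrite gt_eqF.
  rewrite E /Lp_quantile_orlicz.
  have Ek : X w / k - 1 = (X w - k) / k by field; rewrite gt_eqF.
  have -> : pos_part (X w / k - 1) = pos_part (X w - k) / k.
    by rewrite Ek /pos_part maxr_pMl ?invr_ge0 ?(ltW k0)// mul0r.
  have -> : neg_part (X w / k - 1) = neg_part (X w - k) / k.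
    by rewrite Ek /neg_part maxr_pMl ?invr_ge0 ?(ltW k0)// mul0r mulNr.
  rewrite !scale ?pos_part_ge0 ?neg_part_ge0// /C /neg_pow /pos_pow.
  by field; rewrite !gt_eqF.
rewrite -!ge0_expectationZl//;
  try by [exact: m_neg | exact: m_pos | move=> w; rewrite powR_ge0].
rewrite -(expectation_cst P 1) -!ge0_expectationD//.
- by congr expectation; apply/funext.
- by apply: measurable_funM => //; exact: m_pos.
- by move=> w; rewrite mulr_ge0// powR_ge0.
- exact: measurable_orlicz.
- by apply: measurable_funM => //; exact: m_neg.
- by move=> w; apply: Phi_ge0; rewrite divr_ge0 ?X0// ltW.
- by move=> w; rewrite mulr_ge0// powR_ge0.
Qed.

Lemma orlicz_quantile_cond X k : measurable_fun setT X ->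
  (forall w, 0 <= X w) -> 0 < k ->
  ('E_P[fun w => Phi (X w / k)%R] <= 1)%E <->
  (alpha%:E * 'E_P[pos_pow X k] <= (1 - alpha)%:E * 'E_P[neg_pow X k])%E.
Proof.
move=> mX X0 k0; have [C C0] := orlicz_quantile_expectation mX X0 k0.
have nfin := neg_part_moment_fin_num mX X0 k0.
set F := ('E_P[fun w => Phi _])%E; set N := ('E_P[neg_pow _ _])%E in nfin *.
set Q := ('E_P[pos_pow _ _])%E => e.
have Nfin : ((C * (1 - alpha))%:E * N)%E \is a fin_num by rewrite fin_numM.
have -> : (F <= 1)%E = (F + (C * (1 - alpha))%:E * N <=
                        1 + (C * (1 - alpha))%:E * N)%E.
  by rewrite leeD2rE.
rewrite e leeD2lE// !EFinM -!muleA lee_pmul2l//.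
Qed.

Lemma orlicz_premium_Lp_quantile X : measurable_fun setT X ->
  (\forall w \ae P, 0 <= X w) ->
  orlicz_premium P Phi X = Lp_quantile P alpha p X.
Proof.
move=> mX /ae_eq_pos_part XE.
rewrite (orlicz_premium_ae_eq _ XE) (Lp_quantile_ae_eq _ _ XE).
congr ereal_inf; congr image; apply/seteqP; split=> k /= [k0 kP]; split => //;
  apply/orlicz_quantile_cond => //;
  by [exact: measurable_pos_part | move=> w; exact: pos_part_ge0].
Qed.

Lemma orlicz_space_moment (X : {RV P >-> R}) : orlicz_space_ge0 P Phi X ->
  ('E_P[fun w => (X w `^ p)%R] < +oo)%E.
Proof.
have /andP[a0 a1] := alpha01.
move=> [[k k0 EX] X0].
have mX : measurable_fun setT (fun w => `|X w|).
  exact: measurableT_comp.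
have absX0 w : 0 <= `|X w| by [].
have [C C0 e] := orlicz_quantile_expectation mX absX0 k0.
have nfin := neg_part_moment_fin_num mX absX0 k0.
pose aX w := `|X w|.
have Qfin : ('E_P[pos_pow aX k] < +oo)%E.
  rewrite ltey; apply/eqP => Qoo; move: e.
  rewrite Qoo gt0_muley ?lte_fin ?mulr_gt0//.
  rewrite addey// => e.
  have : ('E_P[fun w => Phi (aX w / k)%R] +
      (C * (1 - alpha))%:E * 'E_P[neg_pow aX k] < +oo)%E.
    apply: lte_add_pinfty; first by apply: le_lt_trans EX _; exact: ltry.
    by rewrite ltey_eq fin_numM.
  by rewrite e ltxx.
(* Where X - k >= k one has X <= 2 (X - k), and elsewhere X < 2 k, hence the factor 2^p. The added 1
   covers X < 0, where the real power takes the default value 1. *)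
apply: (@le_lt_trans _ _
  ('E_P[fun w => 2 `^ p * (pos_pow aX k w + k `^ p) + 1]%R)%E).
  apply: ge0_expectation_le.
  - exact: (measurableT_comp (measurable_powR p)).
  - apply: measurable_funD => //; apply: measurable_funM => //.
    by apply: measurable_funD => //; exact: m_pos.
  - by move=> w; rewrite powR_ge0.
  move=> w; have [Xw|Xw] := leP 0 (X w); last first.
    rewrite /powR [X w == 0]lt_eqF// ln0 ?(ltW Xw)// mulr0 expR0 lerDr.
    by rewrite mulr_ge0 ?addr_ge0 ?powR_ge0.
  rewrite /pos_pow /aX ger0_norm//; apply: ler_wpDr => //.
  have [kX|kX] := leP k (X w - k).
    apply: (@le_trans _ _ (2 `^ p * pos_part (X w - k) `^ p)); last first.
      by rewrite ler_wpM2l ?powR_ge0// lerDl powR_ge0.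
    rewrite -powRM ?pos_part_ge0//.
    apply: ge0_ler_powR; rewrite ?nnegrE ?(ltW p0)//.
      by rewrite mulr_ge0 ?pos_part_ge0.
    by rewrite /pos_part max_l; lra.
  apply: (@le_trans _ _ (2 `^ p * k `^ p)); last first.
    by rewrite ler_wpM2l ?powR_ge0// lerDr powR_ge0.
  rewrite -powRM ?(ltW k0)//; apply: ge0_ler_powR; rewrite ?nnegrE ?(ltW p0)//.
    by rewrite mulr_ge0// ltW.
  lra.
have mp := m_pos k mX.
rewrite ge0_expectationD//; last 2 first.
- by apply: measurable_funM => //; apply: measurable_funD.
- by move=> w; rewrite mulr_ge0 ?addr_ge0 ?powR_ge0.
rewrite expectation_cst ge0_expectationZl ?powR_ge0//; last 2 first.
- exact: measurable_funD.
- by move=> w; rewrite addr_ge0 ?powR_ge0.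
rewrite ge0_expectationD//; last 2 first.
- by move=> w; rewrite powR_ge0.
- by move=> w; rewrite powR_ge0.
rewrite expectation_cst; apply: lte_add_pinfty; last exact: ltry.
apply: lte_mul_pinfty; rewrite ?lee_fin ?powR_ge0//.
by apply: lte_add_pinfty => //; exact: ltry.
Qed.

(** For k > 0, k is feasible for X exactly when k + c is feasible for X + c. What remains is to
    treat the feasible values of X + c that do not exceed c. *)
Lemma Lp_quantileD X (c : R) : measurable_fun setT X -> (forall w, 0 <= X w) ->
  0 <= c -> Lp_quantile P alpha p (fun w => X w + c) =
            (Lp_quantile P alpha p X + c%:E)%E.
Proof.
have /andP[a0 a1] := alpha01.
move=> mX X0 c0.
have shift (f : R -> R) k :
    (fun w => f (X w + c - (k + c))) = (fun w => f (X w - k)).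
  by apply/funext => w; congr f; ring.
apply/eqP; rewrite eq_le; apply/andP; split.
  rewrite -leeBlDr//; apply: le_ereal_inf_tmp => _ [k [k0 kP] <-].
  rewrite leeBlDr//; apply: ereal_inf_lbound; exists (k + c) => //=.
  split; first by rewrite ltr_wpDr.
  by rewrite (shift (fun x => pos_part x `^ p)) (shift (fun x => neg_part x `^ p)).
apply: le_ereal_inf_tmp => _ [k [k0 kP] <-].
have [ck|kc] := ltP c k.
  rewrite -leeBrDr// -EFinB; apply: ereal_inf_lbound; exists (k - c) => //=.
  split; first by rewrite subr_gt0.
  have kE : k = k - c + c by ring.
  by move: kP; rewrite {1 2}kE (shift (fun x => pos_part x `^ p))
    (shift (fun x => neg_part x `^ p)).
have mXc : measurable_fun setT (fun w => X w + c) by exact: measurable_funD.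
(* For k <= c the negative part of X + c - k vanishes, so feasibility makes the positive moment 0.
   This excludes k < c, and at k = c it makes every e > 0 feasible for X, whose quantile is then at
   most 0. *)
have neg0 : ('E_P[neg_pow (fun w => X w + c)%R k] = 0)%E.
  transitivity ('E_P[cst 0%R : T -> R])%E; last exact: expectation_cst.
  congr expectation; apply/funext => w.
  rewrite /neg_pow /neg_part max_r ?powR0 ?gt_eqF//.
  by have := X0 w; lra.
have pos0 : ('E_P[pos_pow (fun w => X w + c)%R k] <= 0)%E.
  by move: kP; rewrite neg0 mule0 pmule_rle0 ?lte_fin.
have {kc} kc : k = c.
  apply/eqP; rewrite eq_le kc leNgt; apply/negP => kc'.
  move: pos0; apply/negP; rewrite -ltNge.
  apply: (@lt_le_trans _ _ ((c - k) `^ p)%:E).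
    by rewrite lte_fin powR_gt0// subr_gt0.
  rewrite -(expectation_cst P ((c - k) `^ p)); apply: ge0_expectation_le => //.
  - exact: m_pos.
  - by move=> w; rewrite powR_ge0.
  - move=> w; apply: ge0_ler_powR;
      rewrite ?nnegrE ?pos_part_ge0 ?subr_ge0 ?(ltW p0) ?kc//.
    by rewrite /pos_part le_max; apply/orP; left; have := X0 w; lra.
rewrite kc -[leRHS]add0e leeD2r//; apply/lee_addgt0Pr => e e0.
rewrite add0e; apply: ereal_inf_lbound; exists e => //=; split => //.
apply: (@le_trans _ _ 0%E); last first.
  rewrite mule_ge0 ?lee_fin ?subr_ge0 ?(ltW a1)//.
  by apply: expectation_ge0 => w; rewrite powR_ge0.
rewrite pmule_rle0 ?lte_fin//; apply: le_trans pos0.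
apply: ge0_expectation_le.
- exact: m_pos.
- exact: m_pos.
- by move=> w; rewrite powR_ge0.
- move=> w; apply: ge0_ler_powR; rewrite ?nnegrE ?pos_part_ge0 ?(ltW p0)//.
  rewrite kc addrK /pos_part ge_max !le_max lexx orbT andbT; apply/orP; left; lra.
Qed.

Lemma power_cash_additive : cash_additive P Phi.
Proof.
move=> X [_ X0] c c0.
have mX : measurable_fun setT X by [].
have mXc : measurable_fun setT (fun w => X w + c) by exact: measurable_funD.
rewrite !orlicz_premium_Lp_quantile//; last first.
  by move: X0; apply: filterS => w X0; rewrite addr_ge0.
have XE := ae_eq_pos_part X0.
rewrite (Lp_quantile_ae_eq _ _ XE) -Lp_quantileD//.
- apply: Lp_quantile_ae_eq; move: XE; apply: filterS => w XE; congr (_ + _).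
  exact: XE.
- exact: measurable_pos_part.
- by move=> w; exact: pos_part_ge0.
Qed.
End quantile.

(** * Convexity and concavity of the premium *)

Section convexity.
Hypothesis Phi_increasing : {in `[0, +oo[ &, {homo Phi : x y / x < y}}.

Let orlicz_premium_reduce (X : {RV P >-> R}) : orlicz_space_ge0 P Phi X ->
  [/\ \forall w \ae P, X w = pos_part (X w),
   measurable_fun setT (fun w => pos_part (X w)),
   exists H : R, orlicz_premium P Phi X = H%:E /\ 0 <= H &
   orlicz_premium P Phi X = orlicz_premium P Phi (fun w => pos_part (X w))].
Proof.
move=> [[k k0 Ek] X0]; have XE := ae_eq_pos_part X0; split => //.
- exact: measurable_pos_part.
- have ge0 : (0 <= orlicz_premium P Phi X)%E.
    by apply: le_ereal_inf_tmp => _ [q [q0 _] <-]; rewrite lee_fin ltW.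
  exists (fine (orlicz_premium P Phi X)); rewrite fineK ?fine_ge0//.
  rewrite ge0_fin_numE//; apply: (@le_lt_trans _ _ k%:E); last exact: ltry.
  apply: ereal_inf_lbound; exists k => //; split => //.
  rewrite (@expectation_ae_eq _ _ _ _ _ (fun w => Phi (`|X w| / k)))//.
  by move: X0; apply: filterS => w X0; rewrite ger0_norm.
- exact: orlicz_premium_ae_eq.
Qed.

Let orlicz_premium_comb_reduce (X Y : {RV P >-> R}) (l : R) :
  orlicz_space_ge0 P Phi X -> orlicz_space_ge0 P Phi Y ->
  orlicz_premium P Phi (fun w => l * X w + (1 - l) * Y w) =
  orlicz_premium P Phi (fun w => l * pos_part (X w) + (1 - l) * pos_part (Y w)).
Proof.
move=> [_ /ae_eq_pos_part XE] [_ /ae_eq_pos_part YE]; apply: orlicz_premium_ae_eq.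
by apply: filterS2 XE YE => w {1}-> {1}->.
Qed.

(* With K = l k + (1 - l) k', the point (l x + (1 - l) y) / K is the convex
   combination of x / k and y / k' with weight l k / K. *)
Let comb_scale (x y l k k' : R) : 0 < k -> 0 < k' -> 0 <= l <= 1 ->
  let K := l * k + (1 - l) * k' in let m := l * k / K in
  [/\ 0 < K, 0 <= m <= 1 &
   (l * x + (1 - l) * y) / K = m * (x / k) + (1 - m) * (y / k')].
Proof.
move=> k0 k'0 /andP[l0 l1] K m.
have K0 : 0 < K.
  rewrite /K; move: l0; rewrite le_eqVlt => /predU1P[<-|l0].
    by rewrite mul0r add0r subr0 mul1r.
  by rewrite ltr_pwDl ?mulr_gt0// mulr_ge0 ?subr_ge0// ltW.
split => //.
  rewrite divr_ge0 ?mulr_ge0 ?(ltW k0) ?(ltW K0)//= ler_pdivrMr// mul1r.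
  by rewrite lerDl mulr_ge0 ?subr_ge0// ltW.
by rewrite /m /K; field; rewrite !gt_eqF.
Qed.

Let comb_ge0 (x y l : R) : 0 <= x -> 0 <= y -> 0 <= l <= 1 ->
  0 <= l * x + (1 - l) * y.
Proof.
by move=> x0 y0 /andP[l0 l1]; rewrite addr_ge0// mulr_ge0// subr_ge0.
Qed.

Lemma convex_premium_convex :
  (forall x y l : R, 0 <= x -> 0 <= y -> 0 <= l <= 1 ->
     Phi (l * x + (1 - l) * y) <= l * Phi x + (1 - l) * Phi y) ->
  premium_convex P Phi.
Proof.
move=> cvx X0 Y0 spX spY l l01.
rewrite orlicz_premium_comb_reduce//.
have [_ mX [HX [HXE HX0]] XE] := orlicz_premium_reduce spX.
have [_ mY [HY [HYE HY0]] YE] := orlicz_premium_reduce spY.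
rewrite HXE HYE; move: XE YE; rewrite HXE HYE.
set X := fun w => pos_part (X0 w) in mX *.
set Y := fun w => pos_part (Y0 w) in mY *.
rewrite -[fun w => _ + _]/(fun w => l * X w + (1 - l) * Y w).
have X_ge0 w : 0 <= X w by exact: pos_part_ge0.
have Y_ge0 w : 0 <= Y w by exact: pos_part_ge0.
(* The slack e provides feasible positive k and k' near the premiums, which may themselves be 0 or
   unattained; [comb_scale] then makes l k + (1 - l) k' feasible for the combination. *)
move=> XE YE; apply/lee_addgt0Pr => e e0.
have : (orlicz_premium P Phi X < (HX + e)%:E)%E by rewrite -XE lte_fin ltrDl.
move=> /ereal_inf_lt[_ [k [k0 kP] <-]]; rewrite lte_fin => kH.
have : (orlicz_premium P Phi Y < (HY + e)%:E)%E by rewrite -YE lte_fin ltrDl.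
move=> /ereal_inf_lt[_ [k' [k'0 k'P] <-]]; rewrite lte_fin => k'H.
have /andP[l0 l1] := l01.
pose K := l * k + (1 - l) * k'; pose m := l * k / K.
have K0 : 0 < K by have [] := comb_scale 0 0 k0 k'0 l01.
have m01 : 0 <= m <= 1 by have [] := comb_scale 0 0 k0 k'0 l01.
have /andP[m0 m1] := m01.
apply: (@le_trans _ _ K%:E); last first.
  rewrite -!EFinM -!EFinD lee_fin /K.
  have := ler_wpM2l l0 (ltW kH); have := ler_wpM2l (_ : 0 <= 1 - l) (ltW k'H).
  by rewrite subr_ge0 => /(_ l1); lra.
apply: ereal_inf_lbound; exists K => //; split => //.
have mXk := measurable_orlicz mX X_ge0 k0.
have mYk := measurable_orlicz mY Y_ge0 k'0.
have PXk w : 0 <= Phi (X w / k) by apply: Phi_ge0; rewrite divr_ge0// ltW.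
have PYk w : 0 <= Phi (Y w / k') by apply: Phi_ge0; rewrite divr_ge0// ltW.
apply: (@le_trans _ _
  ('E_P[fun w => m * Phi (X w / k) + (1 - m) * Phi (Y w / k')]%R)%E).
  apply: ge0_expectation_le.
  - apply: measurable_orlicz => //; last by move=> w; exact: comb_ge0.
    by apply: measurable_funD; apply: measurable_funM.
  - by apply: measurable_funD; apply: measurable_funM.
  - by move=> w; apply: Phi_ge0; rewrite divr_ge0 ?comb_ge0// ltW.
  - move=> w; have [_ _ ->] := comb_scale (X w) (Y w) k0 k'0 l01.
    by apply: cvx; rewrite // divr_ge0// ltW.
rewrite ge0_expectationD; last 4 first.
- exact: measurable_funM.
- exact: measurable_funM.
- by move=> w; rewrite mulr_ge0.
- by move=> w; rewrite mulr_ge0 ?subr_ge0.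
rewrite !ge0_expectationZl ?subr_ge0//.
have -> : (1 = m%:E * 1 + (1 - m)%:E * 1 :> \bar R)%E.
  by rewrite !mule1 -EFinD; congr EFin; ring.
by apply: leeD; apply: lee_wpmul2l; rewrite ?lee_fin ?subr_ge0.
Qed.

(** If K were feasible for the combination and below D = l HX + (1 - l) HY, shrinking both premiums
    by the common factor r = K / D < 1 would make them infeasible for X and Y. Concavity then pushes
    the expectation at K above 1. *)
Lemma concave_premium_concave :
  (forall x y l : R, 0 <= x -> 0 <= y -> 0 <= l <= 1 ->
     l * Phi x + (1 - l) * Phi y <= Phi (l * x + (1 - l) * y)) ->
  premium_concave P Phi.
Proof.
move=> ccv X0 Y0 spX spY l l01.
rewrite orlicz_premium_comb_reduce//.
have [_ mX [HX [HXE HX0]] XE] := orlicz_premium_reduce spX.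
have [_ mY [HY [HYE HY0]] YE] := orlicz_premium_reduce spY.
rewrite HXE HYE; move: XE YE; rewrite HXE HYE.
set X := fun w => pos_part (X0 w) in mX *.
set Y := fun w => pos_part (Y0 w) in mY *.
rewrite -[fun w => _ + _]/(fun w => l * X w + (1 - l) * Y w).
have X_ge0 w : 0 <= X w by exact: pos_part_ge0.
have Y_ge0 w : 0 <= Y w by exact: pos_part_ge0.
move=> XE YE; apply: le_ereal_inf_tmp => _ [K [K0 KP] <-].
have /andP[l0 l1] := l01.
have mcomb : measurable_fun setT (fun w => l * X w + (1 - l) * Y w).
  by apply: measurable_funD; apply: measurable_funM.
have mK : measurable_fun setT (fun w => Phi ((l * X w + (1 - l) * Y w) / K)).
  by apply: measurable_orlicz => // w; exact: comb_ge0.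
(* Domination bounds the premium of each summand by K. These bounds rule out l = 0, l = 1 and zero
   premiums, where one term of D vanishes and the shrinking argument would break down. *)
have lower (Z : T -> R) (r HZ : R) : measurable_fun setT Z ->
    (forall w, 0 <= Z w) ->
    HZ%:E = orlicz_premium P Phi Z -> 0 <= r ->
    (forall w, r * Z w <= l * X w + (1 - l) * Y w) -> r * HZ <= K.
  move=> mZ Z_ge0 ZE; rewrite le_eqVlt => /predU1P[<-|r0] rZ.
    by rewrite mul0r ltW.
  rewrite -ler_pdivlMl// mulrC -lee_fin ZE; apply: ereal_inf_lbound.
  exists (K / r) => //; split; first by rewrite divr_gt0.
  apply: le_trans KP; apply: ge0_expectation_le => //.
  - by apply: measurable_orlicz => //; rewrite divr_gt0.
  - by move=> w; apply: Phi_ge0; rewrite divr_ge0// ltW// divr_gt0.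
  - move=> w; apply: (orlicz_le Phi_increasing).
      by rewrite divr_ge0// ltW// divr_gt0.
    rewrite ler_pdivlMr// (_ : _ * K = r * Z w)//.
    by field; rewrite !gt_eqF.
have lHX : l * HX <= K.
  by apply: (lower X) => // w; rewrite lerDl mulr_ge0 ?subr_ge0.
have lHY : (1 - l) * HY <= K.
  by apply: (lower Y) => //; [rewrite subr_ge0 | move=> w; rewrite lerDr mulr_ge0].
rewrite -!EFinM -EFinD lee_fin leNgt; apply/negP => KH.
have l_gt0 : 0 < l.
  by rewrite lt_def l0 andbT; apply/eqP => le0; move: KH lHY; rewrite le0; lra.
have l_lt1 : l < 1.
  by rewrite lt_def l1 andbT; apply/eqP => le1; move: KH lHX; rewrite -le1; lra.
have HX_gt0 : 0 < HX.
  by rewrite lt_def HX0 andbT; apply/eqP => H0; move: KH lHY; rewrite H0; lra.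
have HY_gt0 : 0 < HY.
  by rewrite lt_def HY0 andbT; apply/eqP => H0; move: KH lHX; rewrite H0; lra.
pose D := l * HX + (1 - l) * HY; pose r := K / D.
have D0 : 0 < D by exact: lt_trans KH.
have r0 : 0 < r by rewrite divr_gt0.
have r1 : r < 1 by rewrite ltr_pdivrMr// mul1r.
have kX0 : 0 < r * HX by rewrite mulr_gt0.
have kY0 : 0 < r * HY by rewrite mulr_gt0.
have KE : l * (r * HX) + (1 - l) * (r * HY) = K.
  by rewrite /r /D; field; rewrite gt_eqF.
have above (Z : T -> R) (HZ : R) : HZ%:E = orlicz_premium P Phi Z -> 0 < HZ ->
    (1 < 'E_P[fun w => Phi (Z w / (r * HZ))%R])%E.
  move=> ZE HZ0; rewrite ltNge; apply/negP => h.
  have : (orlicz_premium P Phi Z <= (r * HZ)%:E)%E.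
    apply: ereal_inf_lbound; exists (r * HZ) => //; split => //.
    by rewrite mulr_gt0.
  by rewrite -ZE lee_fin -ler_pdivrMr// divff ?gt_eqF// leNgt r1.
have mX1 := above X HX XE HX_gt0; have mY1 := above Y HY YE HY_gt0.
pose m := l * (r * HX) / K.
have m_gt0 : 0 < m by apply: divr_gt0 => //; apply: mulr_gt0.
have m_lt1 : m < 1.
  by rewrite ltr_pdivrMr// mul1r -KE ltrDl mulr_gt0 ?subr_gt0.
have m01 : 0 <= m <= 1 by rewrite !ltW.
have mXk := measurable_orlicz mX X_ge0 kX0.
have mYk := measurable_orlicz mY Y_ge0 kY0.
have PXk w : 0 <= Phi (X w / (r * HX)) by apply: Phi_ge0; rewrite divr_ge0// ltW.
have PYk w : 0 <= Phi (Y w / (r * HY)) by apply: Phi_ge0; rewrite divr_ge0// ltW.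
suff : (1 < 'E_P[fun w => Phi ((l * X w + (1 - l) * Y w) / K)%R])%E.
  by rewrite ltNge KP.
apply: (@lt_le_trans _ _ ('E_P[fun w => m * Phi (X w / (r * HX)) +
    (1 - m) * Phi (Y w / (r * HY))]%R)%E); last first.
  apply: ge0_expectation_le => //.
  - by apply: measurable_funD; apply: measurable_funM.
  - by move=> w; rewrite addr_ge0// mulr_ge0// ?subr_ge0 ltW.
  - move=> w; have [_ _] := comb_scale (X w) (Y w) kX0 kY0 l01.
    rewrite KE => ->; apply: ccv => //; rewrite divr_ge0// ltW//.
rewrite ge0_expectationD; last 4 first.
- exact: measurable_funM.
- exact: measurable_funM.
- by move=> w; rewrite mulr_ge0// ltW.
- by move=> w; rewrite mulr_ge0// subr_ge0 ltW.
rewrite !ge0_expectationZl ?subr_ge0 ?ltW//.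
have -> : (1 = m%:E * 1 + (1 - m)%:E * 1 :> \bar R)%E.
  by rewrite !mule1 -EFinD; congr EFin; ring.
by apply: lteD; rewrite lte_pmul2l// lte_fin subr_gt0.
Qed.
End convexity.
End sufficiency.

(** * The piecewise linear case *)

Section expectile.
Context (R : realType) (Phi : R -> R) (alpha : R).

Lemma Lp_quantile_orlicz1 :
  Lp_quantile_orlicz alpha 1 = expectile_orlicz alpha.
Proof.
apply/funext => x; rewrite /Lp_quantile_orlicz /expectile_orlicz.
by rewrite !powRr1 ?pos_part_ge0 ?neg_part_ge0.
Qed.

(** In this form the only nonlinear term is the absolute value, so the sign of 2 alpha - 1 decides
    between convexity and concavity. *)
Lemma expectile_orliczE (x : R) : expectile_orlicz alpha x =
  1 + ((2 * alpha - 1) * `|x - 1| + (x - 1)) / 2.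
Proof.
rewrite /expectile_orlicz /pos_part /neg_part; have [x1|x1] := leP 0 (x - 1).
  by rewrite max_r ?oppr_le0// ger0_norm//; lra.
by rewrite max_l ?oppr_ge0 ?ltW// ltr0_norm//; lra.
Qed.

Let norm_convex (x y l : R) : 0 <= l <= 1 ->
  `|l * x + (1 - l) * y - 1| <= l * `|x - 1| + (1 - l) * `|y - 1|.
Proof.
move=> /andP[l0 l1].
rewrite (_ : l * x + _ - 1 = l * (x - 1) + (1 - l) * (y - 1)); last by ring.
apply: le_trans (ler_normD _ _) _.
by rewrite !normrM (ger0_norm l0) [`|1 - l|]ger0_norm ?subr_ge0.
Qed.

Hypothesis Phi_equiv : orlicz_equiv Phi (expectile_orlicz alpha).

Let PhiE : exists2 c : R, 0 < c & forall x, 0 <= x ->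
  Phi x = 1 + c * ((2 * alpha - 1) * `|x - 1| + (x - 1)).
Proof.
case: Phi_equiv => c c0 cE; exists (c^-1 / 2); first by rewrite divr_gt0 ?invr_gt0.
move=> x /cE; rewrite expectile_orliczE => /addrI.
rewrite -[RHS]mulrC => /(canLR (mulfK (lt0r_neq0 c0))) h.
by rewrite -[Phi x](subrK 1) -h; field; rewrite gt_eqF.
Qed.

Lemma expectile_orlicz_convex : 1 / 2 <= alpha ->
  forall x y l : R, 0 <= x -> 0 <= y -> 0 <= l <= 1 ->
  Phi (l * x + (1 - l) * y) <= l * Phi x + (1 - l) * Phi y.
Proof.
move=> a12 x y l x0 y0 l01; have [c c0 cE] := PhiE; have := norm_convex x y l01.
have /andP[l0 l1] := l01.
have a0 : 0 <= 2 * alpha - 1 by lra.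
have z0 : 0 <= l * x + (1 - l) * y by rewrite addr_ge0// mulr_ge0// subr_ge0.
by move=> /(ler_wpM2l (mulr_ge0 (ltW c0) a0)); rewrite !cE//; lra.
Qed.

Lemma expectile_orlicz_concave : alpha <= 1 / 2 ->
  forall x y l : R, 0 <= x -> 0 <= y -> 0 <= l <= 1 ->
  l * Phi x + (1 - l) * Phi y <= Phi (l * x + (1 - l) * y).
Proof.
move=> a12 x y l x0 y0 l01; have [c c0 cE] := PhiE; have := norm_convex x y l01.
have /andP[l0 l1] := l01.
have a0 : 0 <= 1 - 2 * alpha by lra.
have z0 : 0 <= l * x + (1 - l) * y by rewrite addr_ge0// mulr_ge0// subr_ge0.
by move=> /(ler_wpM2l (mulr_ge0 (ltW c0) a0)); rewrite !cE//; lra.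
Qed.
End expectile.

Theorem theorem12 (d : measure_display) (T : measurableType d) (R : realType)
    (P : probability T R) (P_nonatomic : nonatomic P)
    (Phi : R -> R) (Phi_orlicz : generalized_orlicz Phi)
    (Phi_continuous : {within `[0, +oo[, continuous Phi})
    (Phi_increasing : {in `[0, +oo[ &, {homo Phi : x y / x < y}}) :
  [/\ cash_additive P Phi <->
        (exists alpha p : R, [/\ 0 < alpha < 1, 0 < p &
           orlicz_equiv Phi (Lp_quantile_orlicz alpha p)]),
      (forall alpha p : R, 0 < alpha < 1 -> 0 < p ->
         orlicz_equiv Phi (Lp_quantile_orlicz alpha p) ->
         forall X : {RV P >-> R}, orlicz_space_ge0 P Phi X ->
           ('E_P[fun w => (X w `^ p)%R] < +oo)%E /\
           orlicz_premium P Phi X = Lp_quantile P alpha p X),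
      (cash_additive P Phi /\ premium_convex P Phi) <->
        (exists alpha : R, [/\ 0 < alpha < 1, 1 / 2 <= alpha &
           orlicz_equiv Phi (expectile_orlicz alpha)]),
      (cash_additive P Phi /\ premium_concave P Phi) <->
        (exists alpha : R, [/\ 0 < alpha < 1, alpha <= 1 / 2 &
           orlicz_equiv Phi (expectile_orlicz alpha)]) &
      (forall alpha : R, 0 < alpha < 1 ->
         orlicz_equiv Phi (expectile_orlicz alpha) ->
         forall X : {RV P >-> R}, orlicz_space_ge0 P Phi X ->
           ('E_P[fun w => X w] < +oo)%E /\
           orlicz_premium P Phi X = expectile P alpha X)].
Proof.
have power := cash_additive_power P_nonatomic Phi_orlicz Phi_continuous
  Phi_increasing.
have premiumE alpha p : 0 < alpha < 1 -> 0 < p ->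
    orlicz_equiv Phi (Lp_quantile_orlicz alpha p) ->
    forall X : {RV P >-> R}, orlicz_space_ge0 P Phi X ->
      ('E_P[fun w => (X w `^ p)%R] < +oo)%E /\
      orlicz_premium P Phi X = Lp_quantile P alpha p X.
  move=> a01 p0 PhiE X spX; split.
    exact: (orlicz_space_moment Phi_orlicz a01 p0 PhiE).
  by apply: (orlicz_premium_Lp_quantile Phi_orlicz a01 p0 PhiE) => //; case: spX.
split => //.
- split; first exact: power.
  move=> [alpha [p [a01 p0 PhiE]]].
  exact: (power_cash_additive Phi_orlicz a01 p0 PhiE).
- split=> [[/power[alpha [p [a01 p0 PhiE]]]]|[alpha [a01 a12 PhiE]]].
    move=> /(convex_midpoint P_nonatomic Phi_orlicz Phi_continuous Phi_increasing).
    move=> /(midpoint_convex_exponent a01 p0 PhiE)[p1 a12].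
    by exists alpha; move: PhiE; rewrite p1 Lp_quantile_orlicz1.
  split; last exact/convex_premium_convex/(expectile_orlicz_convex PhiE).
  apply: (power_cash_additive Phi_orlicz a01 ltr01).
  by rewrite Lp_quantile_orlicz1.
- split=> [[/power[alpha [p [a01 p0 PhiE]]]]|[alpha [a01 a12 PhiE]]].
    move=> /(concave_midpoint P_nonatomic Phi_orlicz Phi_continuous Phi_increasing).
    move=> /(midpoint_concave_exponent a01 p0 PhiE)[p1 a12].
    by exists alpha; move: PhiE; rewrite p1 Lp_quantile_orlicz1.
  split; last first.
    apply: (concave_premium_concave Phi_orlicz Phi_increasing).
    exact: (expectile_orlicz_concave PhiE a12).
  apply: (power_cash_additive Phi_orlicz a01 ltr01).
  by rewrite Lp_quantile_orlicz1.
- move=> alpha a01; rewrite -Lp_quantile_orlicz1 => PhiE X spX.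
  have [moment ->] := premiumE _ _ a01 ltr01 PhiE X spX; split => //.
  (* The power with exponent 1 is the identity only on nonnegative reals, so the two integrands
     agree almost surely. *)
  rewrite (@expectation_ae_eq _ _ _ P _ (fun w => X w `^ 1))//.
  by case: spX => _; apply: filterS => w X0; rewrite powRr1.
Qed.
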